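(* In the group $\mathbb{Z}^\omega$, for every ordinal $\xi$ with $2\le \xi<\omega_1$ there exists a Haar null set $E\subseteq\mathbb{Z}^\omega$ that is the difference of two $\mathbf{\Pi}^0_\xi$ subsets of $\mathbb{Z}^\omega$ but is not contained in any $\mathbf{\Pi}^0_\xi$ Haar null subset of $\mathbb{Z}^\omega$.
   Context: $\mathbb{Z}^\omega$ is the (non-locally-compact abelian Polish) group of integer sequences under coordinatewise addition, with the product of discrete topologies. If $G$ is a Polish group, a set $A\subseteq G$ is called Haar null if there exist a Borel set $B\supseteq A$ and a Borel probability measure $\mu$ on $G$ such that $\mu(gBh)=0$ for every $g,h\in G$. $\mathbf{\Pi}^0_\xi$ denotes the corresponding multiplicative class of the Borel hierarchy (e.g. $\mathbf{\Pi}^0_2$ = $G_\delta$). *)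

(* Defs.v *)
From HB Require Import structures.
From mathcomp Require Import all_boot all_order all_algebra.
From mathcomp Require Import all_classical all_reals all_analysis.
Set Implicit Arguments. Unset Strict Implicit. Unset Printing Implicit Defensive.
Import Order.TTheory GRing.Theory Num.Theory.
Local Open Scope classical_set_scope.
Local Open Scope ring_scope.

Definition Zomega := {ptws nat -> discrete_topology int}.
HB.instance Definition _ := Topological.on Zomega.
(* a base point, needed to build the Borel measurable type *)
HB.instance Definition _ := isPointed.Build Zomega (fun _ => 0%R).

Definition zadd (x y : Zomega) : Zomega := fun n => (x n + y n)%R.

Definition translate (g : Zomega) (B : set Zomega) (h : Zomega) : set Zomega :=
  [set zadd (zadd g b) h | b in B].

Definition borelZ : measurableType _ := g_sigma_algebraType (@open Zomega).

Definition Borel (A : set Zomega) : Prop := <<s @open Zomega >> A.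

Definition HaarNull (R : realType) (A : set Zomega) : Prop :=
  exists B : set Zomega, [/\ Borel B, A `<=` B &
    exists mu : probability borelZ R,
      forall g h : Zomega, mu (translate g B h : set borelZ) = 0%E].

(** Countable ordinals, represented by Brouwer trees. *)
Inductive cord : Type :=
| OZ : cord
| OS : cord -> cord
| OL : (nat -> cord) -> cord.

Inductive ole : cord -> cord -> Prop :=
| ole_Z b : ole OZ b
| ole_S a b : olt a b -> ole (OS a) b
| ole_L f b : (forall n, ole (f n) b) -> ole (OL f) b
with olt : cord -> cord -> Prop :=
| olt_S a b : ole a b -> olt a (OS b)
| olt_L a f n : olt a (f n) -> olt a (OL f).

Definition oone : cord := OS OZ.
Definition otwo : cord := OS oone.

(** Additive Borel classes Sigma^0_xi (xi >= 1) on Z^omega: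
    Sigma^0_1 = open sets; Sigma^0_xi = countable unions of sets each in
    Pi^0_eta for some eta < xi (open sets included).  [Sigma0 OZ] is empty. *)
Inductive Sigma0 : cord -> set Zomega -> Prop :=
| Sigma0_open xi A : ole oone xi -> open A -> Sigma0 xi A
| Sigma0_union xi (eta : nat -> cord) (A : nat -> set Zomega) :
    (forall n, olt (eta n) xi) -> (forall n, Sigma0 (eta n) (~` A n)) ->
    Sigma0 xi (\bigcup_n A n).

Definition Pi0 (xi : cord) (A : set Zomega) : Prop := Sigma0 xi (~` A).

(* Main.v *)
Require Import Defs.
From HB Require Import structures.
From mathcomp Require Import all_boot all_order all_algebra.
From mathcomp Require Import all_classical all_reals all_analysis.
From mathcomp Require Import measurable_realfun zify lra.
Local Open Scope classical_set_scope.
Set Implicit Arguments. Unset Strict Implicit. Unset Printing Implicit Defensive.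
Import Order.TTheory GRing.Theory Num.Theory.

(* Each parameter [m] owns the interval of integers of radius [radius m] around
   [center m], and these intervals are disjoint; hence the even coordinates of a
   point [z] determine a sequence of parameters [rho z], which survives bounded
   perturbations.  The parameters [x] code a Sigma^0_xi set, through a universal
   set [W], and a law [kappa x] on the fibre of [rho] over [x]: that of a random
   point whose coordinates are step functions of one uniform variable.  Every [x]
   codes such a law, so [{x | kappa x S > r}] is Sigma^0_xi whenever [S] is.

   When [kappa x W > 0], a point of [W] over [x] is selected as in random forcing:
   one decides, step by step and always keeping positive measure,
   the coordinates of the point and its membership in the countably many sets of
   lower class from which [W] is built.  Taking the least admissible decision
   keeps the history of decisions Delta^0_xi, so the set [E] of selected points
   is a difference of two Pi^0_xi sets.  Two points of [E] with the same even
   coordinates are equal, so [E] is Haar null, as witnessed by a law that is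
   deterministic on the even coordinates and injective on the odd ones.

   Let [F] be a Haar null Pi^0_xi set with witness [mu].  Choose [x] coding the
   complement of [F] and step functions which agree, with probability at least 1/2,
   with the quantile map carrying the uniform law to [mu].  Then [kappa x F < 1],
   whence [kappa x W > 0], and the point of [E] over [x] is not in [F]. *)

(** * Countable ordinals *)

Scheme ole_mind := Minimality for ole Sort Prop
  with olt_mind := Minimality for olt Sort Prop.

Lemma ole_OL a f n : ole a (f n) -> ole a (OL f).
Proof.
elim: a => [|a _|g IH] h; first exact: ole_Z.
- by inversion h; subst; apply: ole_S; apply: olt_L; eassumption.
- by inversion h; subst; apply: ole_L => m; apply: IH.
Qed.

Lemma ole_refl a : ole a a.
Proof.
elim: a => [|a IH|f IH]; first exact: ole_Z.
- exact/ole_S/olt_S.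
- by apply: ole_L => n; apply: (@ole_OL _ _ n).
Qed.

Lemma olt_OZ a b : olt a b -> olt OZ b.
Proof.
elim: b => [|b _|f IH] h; inversion h; subst.
- exact/olt_S/ole_Z.
- by apply: (@olt_L _ _ n); apply: IH.
Qed.

(** The weak and the strict transitivity feed each other, so the mutual induction carries both; an
    inner induction on [c] descends to the successor from which a strict inequality was derived. *)
Lemma ole_trans_mix a b : ole a b ->
  forall c, (ole b c -> ole a c) /\ (olt b c -> olt a c).
Proof.
move: a b; apply: (@ole_mind
  (fun a b => forall c, (ole b c -> ole a c) /\ (olt b c -> olt a c))
  (fun a b => forall c, ole b c -> olt a c)).
- by move=> b c; split=> [_|/olt_OZ//]; exact: ole_Z.
- move=> a b _ IH c; split=> [bc|]; first exact/ole_S/IH.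
  elim: c => [|c _|f IHf] h; inversion h; subst.
    by apply/olt_S/ole_S/IH.
  by apply: (@olt_L _ _ n); apply: IHf.
- move=> f b _ IH c; split=> [bc|].
    by apply: ole_L => n; apply: (IH n c).1.
  elim: c => [|c _|g IHg] h; inversion h; subst.
    by apply/olt_S/ole_L => n; apply: (IH n c).1.
  by apply: (@olt_L _ _ n); apply: IHg.
- by move=> a b _ IH c h; inversion h; subst; apply: (IH c).2.
- by move=> a f n _ IH c h; inversion h; subst; apply: IH.
Qed.

Lemma ole_trans b a c : ole a b -> ole b c -> ole a c.
Proof. by move=> /ole_trans_mix/(_ c)[]. Qed.

Lemma ole_olt_trans b a c : ole a b -> olt b c -> olt a c.
Proof. by move=> /ole_trans_mix/(_ c)[]. Qed.

Lemma oleS a : ole a (OS a).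
Proof.
elim: a => [|a IH|f IH]; first exact: ole_Z.
- exact/ole_S/olt_S.
- apply: ole_L => n; apply: (ole_trans (IH n)).
  by apply/ole_S/olt_S; apply: (@ole_OL _ _ n); apply: ole_refl.
Qed.

Lemma olt_ole_trans b a c : olt a b -> ole b c -> olt a c.
Proof.
move=> ab bc; suff h : ole (OS a) c by inversion h.
by apply: ole_trans bc; apply: ole_S.
Qed.

Lemma oltW a b : olt a b -> ole a b.
Proof. by move=> ab; apply: (ole_trans (oleS a)); apply: ole_S. Qed.

(** Comparability is classical: at a limit one decides whether some term of its sequence strictly
    exceeds the other tree. *)
Lemma ole_or_olt a b : ole a b \/ olt b a.
Proof.
elim: a b => [|a IHa|f IHf] b; first by left; exact: ole_Z.
- suff [] : olt a b \/ ole b a by [left; exact: ole_S|right; exact: olt_S].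
  elim: b => [|b _|g IHg]; first by right; exact: ole_Z.
    by have [ab|ba] := IHa b; [left; exact: olt_S|right; exact: ole_S].
  have [[n an]|h] := pselect (exists n, olt a (g n)); first by left; exact: olt_L an.
  by right; apply: ole_L => n; have [an|//] := IHg n; case: h; exists n.
- have [[n an]|h] := pselect (exists n, olt b (f n)); first by right; exact: olt_L an.
  by left; apply: ole_L => n; have [//|an] := IHf n b; case: h; exists n.
Qed.

Lemma olt_wf : well_founded olt.
Proof.
suff H b : forall a, ole a b -> Acc olt a by move=> b; exact: (H b b (ole_refl b)).
elim: b => [|b IH|f IH] a ab; apply: Acc_intro => c ca;
  have h := olt_ole_trans ca ab; inversion h; subst.
- exact: IH.
- by apply: (Acc_inv (IH n _ (ole_refl _))).
Qed.

Lemma olt_max c a b : olt a c -> olt b c ->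
  exists m, [/\ olt m c, ole a m & ole b m].
Proof.
move=> ac bc; have [ab|ba] := ole_or_olt a b.
  by exists b; split=> //; exact: ole_refl.
by exists a; split=> //; [exact: ole_refl|exact: oltW].
Qed.

Lemma olt_OLP a f : olt a (OL f) -> exists n, olt a (f n).
Proof. by move=> h; inversion h; subst; exists n. Qed.

Lemma olt_OSP a b : olt a (OS b) -> ole a b.
Proof. by move=> h; inversion h. Qed.

(** Keeps the inductions on [xi] countable. A successor takes a constant sequence; a limit
    interleaves the sequences of its terms, with [oone] as filler where a term is at most one. *)
Lemma olt_cofinal xi : olt oone xi -> exists e : nat -> cord,
  (forall n, olt (e n) xi /\ ole oone (e n)) /\
  (forall eta, olt eta xi -> exists n, ole eta (e n)).
Proof.
elim: xi => [|a _|f IH] h; inversion h; subst.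
- exists (fun=> a); split=> [n|eta ea]; first by split=> //; exact/olt_S/ole_refl.
  by exists 0; inversion ea.
- have /choice[e he] : forall k, exists e : nat -> cord, olt oone (f k) ->
      (forall n, olt (e n) (f k) /\ ole oone (e n)) /\
      (forall eta, olt eta (f k) -> exists n, ole eta (e n)).
    move=> k; have [/IH[e ?]|?] := pselect (olt oone (f k)); first by exists e.
    by exists (fun=> OZ).
  pose g p := if unpickle p is Some (k, m) then
    (if `[< olt oone (f k) >] then e k m else oone) else oone.
  exists g; split=> [p|eta].
    rewrite /g; case: unpickle => [[k m]|]; last by split; [|exact: ole_refl].
    case: asboolP => [/he[+ _] |_]; last by split; [|exact: ole_refl].
    by move=> /(_ m)[lt le]; split=> //; exact: olt_L lt.
  move=> /olt_OLP[k ek]; have [f1|f1] := ole_or_olt (f k) oone.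
    by exists 0; apply: ole_trans (ole_Z _); exact/olt_OSP/(olt_ole_trans ek).
  have [_ /(_ _ ek)[m em]] := he _ f1.
  by exists (pickle (k, m)); rewrite /g pickleK; case: asboolP.
Qed.

(** * Additive Borel classes of Z^omega *)

Lemma open_coordinate n (P : set int) : open [set z : Zomega | P (z n)].
Proof.
pose K (_ : nat) : topologicalType := discrete_topology int.
have c : continuous (@proj nat K n : prod_topology K -> K n).
  exact: proj_continuous.
move/continuousP: c => c; exact: (c P (discrete_open _)).
Qed.

Lemma cvg_coordinates (u : nat -> Zomega) (z : Zomega) :
  (forall n i, (i < n)%N -> u n i = z i) -> u @ \oo --> z.
Proof.
move=> uz; apply/cvg_sup => i A [B [[C oC <-]] Cz BA].
exists i.+1 => // n /= ni; apply: BA => /=.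
by move: Cz; rewrite /= (uz n i).
Qed.

(** If no prefix of [z] sufficed, counterexamples agreeing with [z] below [n] would converge to [z]
    while staying outside the neighbourhood [A]. Conversely [A] is a union of sets that fix finitely
    many coordinates. *)
Lemma open_prefixP (A : set Zomega) : open A <->
  (forall z, A z -> exists n, forall z', (forall i, (i < n)%N -> z' i = z i) -> A z').
Proof.
split=> [oA z Az|h].
- apply: contrapT => /forallNP h.
  have /choice[u hu] : forall n, exists z' : Zomega,
      (forall i, (i < n)%N -> z' i = z i) /\ ~ A z'.
    move=> n; have := h n; rewrite -existsNE => -[z' /not_implyP[? ?]].
    by exists z'.
  have : u @ \oo --> z by apply: cvg_coordinates => n i ?; apply: (hu n).1.
  by move=> /(_ A (open_nbhs_nbhs (conj oA Az)))[n _ /(_ n (leqnn n))/(hu n).2].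
- suff -> : A = \bigcup_(p in [set p : Zomega * nat | forall z',
      (forall i, (i < p.2)%N -> z' i = p.1 i) -> A z'])
      [set z' | forall i, (i < p.2)%N -> z' i = p.1 i].
    apply: bigcup_open => -[z n] _ /=; elim: n => [|n IH].
      by rewrite (_ : [set _ | _] = setT); [exact: openT|apply/seteqP; split].
    rewrite (_ : [set _ | _] = [set z' : Zomega | forall i, (i < n)%N -> z' i = z i]
        `&` [set z' | [set z n] (z' n)]); first exact: openI (open_coordinate _ _).
    apply/seteqP; split=> [z' h'|z' [h1 h2] i].
      by split=> /= [i ?|]; apply: h' => //; exact: ltnW.
    by rewrite ltnS leq_eqVlt => /orP[/eqP->|]; [exact: h2|exact: h1].
  apply/seteqP; split=> [z /h[n hn]|z' [[z n] /= hn] /hn//].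
  by exists (z, n).
Qed.

(** * Finite prefixes and a countable clopen base *)

Definition prefix (z : Zomega) n : seq int := mkseq z n.

Lemma eq_prefix n (z z' : Zomega) :
  (forall i, (i < n)%N -> z' i = z i) <-> prefix z' n = prefix z n.
Proof.
split=> [h|h i ni]; last by rewrite -(nth_mkseq 0%R z ni) -(nth_mkseq 0%R z' ni) -/(prefix _ _) h.
by apply/eq_in_map => i; rewrite mem_iota => /h.
Qed.

Lemma open_prefix n (P : set (seq int)) : open [set z | P (prefix z n)].
Proof. by apply/open_prefixP => z Pz; exists n => z' /eq_prefix /= ->. Qed.

Definition cyl (s : seq int) : set Zomega := [set z | prefix z (size s) = s].

Lemma open_cyl s : open (cyl s).
Proof. exact: (open_prefix (size s) [set s]). Qed.

Lemma open_setC_cyl s : open (~` cyl s).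
Proof. exact: (open_prefix (size s) (~` [set s])). Qed.

Lemma cyl_prefix z n : cyl (prefix z n) z.
Proof. by rewrite /cyl /= size_mkseq. Qed.

Definition basic k : set Zomega := if unpickle k is Some s then cyl s else set0.

Lemma open_basic k : open (basic k).
Proof. by rewrite /basic; case: (unpickle k) => *; [exact: open_cyl|exact: open0]. Qed.

Lemma open_setC_basic k : open (~` basic k).
Proof.
rewrite /basic; case: (unpickle k) => *; first exact: open_setC_cyl.
by rewrite setC0; exact: openT.
Qed.

Lemma open_bigcup_basic (A : set Zomega) : open A ->
  A = \bigcup_(k in [set k | basic k `<=` A]) basic k.
Proof.
move=> /open_prefixP oA; apply/seteqP; split=> [z Az|z [k /= kA /kA]//].
have [n hn] := oA z Az; have e : basic (pickle (prefix z n)) = cyl (prefix z n).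
  by rewrite /basic pickleK.
exists (pickle (prefix z n)); rewrite /= e; last exact: cyl_prefix.
by move=> z'; rewrite /cyl /= size_mkseq => /eq_prefix/hn.
Qed.

Lemma Sigma0_mono a b A : ole a b -> Sigma0 a A -> Sigma0 b A.
Proof.
move=> ab h; inversion h; subst; first by apply: Sigma0_open => //; exact: ole_trans H ab.
by apply: (@Sigma0_union _ eta) => // n; exact: olt_ole_trans (H n) ab.
Qed.

Lemma Sigma0_ole_oone xi A : Sigma0 xi A -> ole oone xi.
Proof.
move=> h; inversion h; subst=> //.
exact/ole_S/(ole_olt_trans (ole_Z _))/(H 0).
Qed.

(** The union constructor cannot apply: an inhabited class has level at least one, whereas the
    members of the union would need levels strictly below one. *)
Lemma Sigma0_oone xi A : ole xi oone -> Sigma0 xi A -> open A.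
Proof.
move=> x1 h; inversion h; subst=> //.
have /ole_olt_trans/(_ (olt_ole_trans (H 0) x1))/olt_OSP := Sigma0_ole_oone (H0 0).
by move=> e; inversion e as [|? ? e'|]; inversion e'.
Qed.

Lemma Sigma0_bigcupC xi (B : nat -> set Zomega) :
  (forall n, exists2 eta, olt eta xi & Sigma0 eta (B n)) ->
  Sigma0 xi (\bigcup_n ~` B n).
Proof.
move=> h.
have /choice[eta he] : forall n, exists eta, olt eta xi /\ Sigma0 eta (B n).
  by move=> n; have [e ? ?] := h n; exists e.
apply: (@Sigma0_union _ eta) => n; first by have [] := he n.
by rewrite setCK; have [] := he n.
Qed.

Lemma Sigma0P xi A : olt oone xi -> Sigma0 xi A <->
  exists2 B : nat -> set Zomega,
    forall n, exists2 eta, olt eta xi & Sigma0 eta (B n) & A = \bigcup_n ~` B n.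
Proof.
move=> x1; split=> [h|[B ? ->]]; last exact: Sigma0_bigcupC.
inversion h; subst; last first.
  exists (fun n => ~` A0 n); last by apply: eq_bigcupr => n _; rewrite setCK.
  by move=> n; exists (eta n).
exists (fun k => if `[< basic k `<=` A >] then ~` basic k else setT).
  move=> k; exists oone => //; apply: Sigma0_open; first exact: ole_refl.
  by case: ifP => _; [exact: open_setC_basic|exact: openT].
rewrite {1}(open_bigcup_basic H0); apply/seteqP; split=> z [k].
  by move=> /= kA kz; exists k => //; rewrite asboolT//; apply.
by move=> _; case: asboolP => [kA|_ /(_ I)//]; rewrite setCK => kz; exists k.
Qed.

Lemma Sigma0_setC_lt eta xi A : olt eta xi -> Sigma0 eta A -> Sigma0 xi (~` A).
Proof.
move=> ex hA; rewrite (_ : ~` A = \bigcup_(_ in @setT nat) ~` A).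
  by apply: Sigma0_bigcupC => _; exists eta.
by rewrite bigcup_const//; exists 0.
Qed.

Lemma Sigma0_lt eta xi A : olt eta xi -> Sigma0 eta A -> Sigma0 xi A.
Proof. by move=> /oltW; exact: Sigma0_mono. Qed.

Lemma Sigma0_bigcup xi (A : nat -> set Zomega) :
  (forall n, Sigma0 xi (A n)) -> Sigma0 xi (\bigcup_n A n).
Proof.
move=> h; have [x1|x1] := ole_or_olt xi oone.
  apply: Sigma0_open; first exact: Sigma0_ole_oone (h 0%N).
  by apply: bigcup_open => n _; apply: (Sigma0_oone x1).
have /choice[B hB] : forall n, exists B : nat -> set Zomega,
    (forall m, exists2 eta, olt eta xi & Sigma0 eta (B m)) /\ A n = \bigcup_m ~` B m.
  by move=> n; have /(Sigma0P _ x1)[B ? ?] := h n; exists B.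
rewrite (_ : \bigcup_n A n = \bigcup_p ~` (if unpickle p is Some (n, m) then B n m
    else setT)).
  apply: Sigma0_bigcupC => p; case: unpickle => [[n m]|]; first by have [] := hB n.
  exists oone => //; apply: Sigma0_open; [exact: ole_refl|exact: openT].
apply/seteqP; split=> z.
  move=> [n _]; rewrite (hB n).2 => -[m _ zB].
  by exists (pickle (n, m)) => //; rewrite pickleK.
move=> [p _]; case: unpickle => [[n m] zB|/(_ I)//].
by exists n => //; rewrite (hB n).2; exists m.
Qed.

Lemma Sigma0U xi A B : Sigma0 xi A -> Sigma0 xi B -> Sigma0 xi (A `|` B).
Proof.
move=> hA hB; rewrite (_ : A `|` B = \bigcup_n (if n is 0 then A else B)).
  by apply: Sigma0_bigcup => -[].
apply/seteqP; split=> z; first by move=> [zA|zB]; [exists 0|exists 1].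
by move=> [[|n] _ h]; [left|right].
Qed.

Lemma Sigma0_ltU xi A B :
  (exists2 eta, olt eta xi & Sigma0 eta A) -> (exists2 eta, olt eta xi & Sigma0 eta B) ->
  exists2 eta, olt eta xi & Sigma0 eta (A `|` B).
Proof.
move=> [a ax hA] [b bx hB]; have [m [mx am bm]] := olt_max ax bx.
by exists m => //; apply: Sigma0U; [exact: Sigma0_mono hA|exact: Sigma0_mono hB].
Qed.

Lemma Sigma0I xi A B : Sigma0 xi A -> Sigma0 xi B -> Sigma0 xi (A `&` B).
Proof.
have [x1 hA hB|x1] := ole_or_olt xi oone.
  by apply: Sigma0_open; [exact: Sigma0_ole_oone hA|apply: openI; exact: Sigma0_oone x1 _].
move=> /(Sigma0P _ x1)[A' hA ->] /(Sigma0P _ x1)[B' hB ->].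
rewrite setI_bigcupl; apply: Sigma0_bigcup => n.
rewrite setIC setI_bigcupl; apply: Sigma0_bigcup => m.
by rewrite -setCU; have [e ex] := Sigma0_ltU (hB m) (hA n); exact: Sigma0_setC_lt.
Qed.

Lemma Sigma0_ltI xi A B :
  (exists2 eta, olt eta xi & Sigma0 eta A) -> (exists2 eta, olt eta xi & Sigma0 eta B) ->
  exists2 eta, olt eta xi & Sigma0 eta (A `&` B).
Proof.
move=> [a ax hA] [b bx hB]; have [m [mx am bm]] := olt_max ax bx.
by exists m => //; apply: Sigma0I; [exact: Sigma0_mono hA|exact: Sigma0_mono hB].
Qed.

Lemma Sigma0T xi : ole oone xi -> Sigma0 xi setT.
Proof. by move=> x1; apply: Sigma0_open => //; exact: openT. Qed.

Lemma Sigma00 xi : ole oone xi -> Sigma0 xi set0.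
Proof. by move=> x1; apply: Sigma0_open => //; exact: open0. Qed.

Lemma Sigma0_preimage (f : Zomega -> Zomega) xi A :
  (forall B, open B -> open (f @^-1` B)) -> Sigma0 xi A -> Sigma0 xi (f @^-1` A).
Proof.
move=> cf; elim=> {xi A} [xi A x1 oA|xi eta A ex _ IH].
  by apply: Sigma0_open => //; exact: cf.
by rewrite preimage_bigcup; apply: (@Sigma0_union _ eta).
Qed.

Lemma Borel_setC A : Borel A -> Borel (~` A).
Proof.
have [_ hC _] := smallest_sigma_algebra setT (@open Zomega).
by rewrite -setTD; exact: hC.
Qed.

Lemma Sigma0_Borel xi A : Sigma0 xi A -> Borel A.
Proof.
elim=> {xi A} [xi A x1 oA|xi eta A ex _ IH]; first exact: sub_gen_smallest.
have [_ _ hU] := smallest_sigma_algebra setT (@open Zomega).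
by apply: hU => n; rewrite -(setCK (A n)); exact: Borel_setC.
Qed.

(** * Universal sets *)

(** The code of an open set is the indicator of the basic sets that it contains. *)
Lemma open_universal (delta : Zomega -> nat -> nat) :
  (forall n P, open [set z | P (delta z n)]) ->
  exists2 W : set Zomega, open W & forall A, open A ->
    exists d : nat -> nat, forall z, (forall n, delta z n = d n) -> (W z <-> A z).
Proof.
move=> od; exists (\bigcup_k ([set z | delta z k <> 0] `&` basic k)).
  apply: bigcup_open => k _; apply: openI; last exact: open_basic.
  exact: (od k (fun m => m <> 0)).
move=> A oA; exists (fun k => nat_of_bool `[< basic k `<=` A >]) => z zd; split.
  by move=> [k _ [/= +]]; rewrite zd; case: asboolP => // kA _; exact: kA.
rewrite {1}(open_bigcup_basic oA) => -[k /= kA kz].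
by exists k => //; split=> //=; rewrite zd; case: asboolP.
Qed.

(** The code is read off the point itself by [delta], so [W] and [A] need agree only on one fibre of
    [delta]. In the induction the slot [q] offers the level [e q.2] to the [q.1]-th set of a union,
    and owns a subsequence of [delta]. *)
Lemma Sigma0_universal xi (delta : Zomega -> nat -> nat) :
  ole oone xi -> (forall n P, open [set z | P (delta z n)]) ->
  exists2 W : set Zomega, Sigma0 xi W & forall A, Sigma0 xi A ->
    exists d : nat -> nat, forall z, (forall n, delta z n = d n) -> (W z <-> A z).
Proof.
elim/(well_founded_ind olt_wf): xi delta => xi IH delta x1 od.
have [x1'|{}x1] := ole_or_olt xi oone.
  have [W oW hW] := open_universal od; exists W; first exact: Sigma0_open.
  by move=> A /(Sigma0_oone x1')/hW.
have [e [e1 ecof]] := olt_cofinal x1.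
have /choice[W hW] : forall q : nat * nat, exists W : set Zomega, Sigma0 (e q.2) W /\
    forall A, Sigma0 (e q.2) A -> exists d : nat -> nat,
      forall z, (forall n, delta z (pickle (q, n)) = d n) -> (W z <-> A z).
  move=> q; have [ex e1q] := e1 q.2.
  have [W ? ?] := IH _ ex (fun z n => delta z (pickle (q, n))) e1q (fun n => od _).
  by exists W.
pose B k := if unpickle k is Some q then W q else setT.
exists (\bigcup_k ~` B k).
  apply: Sigma0_bigcupC => k; rewrite /B; case: (unpickle k) => [q|].
    by exists (e q.2); [exact: (e1 _).1|exact: (hW _).1].
  by exists oone => //; apply/Sigma0T/ole_refl.
move=> A /(Sigma0P _ x1)[C hC ->].
have /choice[f hf] : forall n, exists i, Sigma0 (e i) (C n).
  move=> n; have [eta /ecof[i ei] h] := hC n.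
  by exists i; exact: Sigma0_mono h.
(* The complement of [setT] adds nothing to the union, so [setT] fills the slots whose level is not
   the chosen one. *)
pose C' (q : nat * nat) := if q.2 == f q.1 then C q.1 else setT.
have /choice[d hd] : forall q : nat * nat, exists d : nat -> nat,
    forall z, (forall n, delta z (pickle (q, n)) = d n) -> (W q z <-> C' q z).
  move=> q; apply: (hW q).2; rewrite /C'; case: eqP => [->|_]; first exact: hf.
  by apply/Sigma0T/(e1 _).2.
exists (fun k => if unpickle k is Some (q, n) then d q n else 0) => z zd.
have {}hd q : W q z <-> C' q z by apply: hd => n; rewrite zd pickleK.
split=> [[k _]|[n _ nC]].
  rewrite /B; case: (unpickle k) => [q|/(_ I)//] /= /(contra_not (hd q).2).
  by rewrite /C'; case: eqP => [_ h|_ []//]; exists q.1.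
exists (pickle (n, f n)) => //; rewrite /B pickleK /= => /(hd _).1.
by rewrite /C' /= eqxx.
Qed.

(** * Measuring Borel sets with a parametrised family of laws *)

Section RealProbability.
Context d (T : measurableType d) (R : realType) (P : probability T R).
Implicit Types (A B : set T) (F : nat -> set T).

Definition pr A : R := fine (P A).

Lemma prE A : measurable A -> P A = (pr A)%:E.
Proof. by move=> mA; rewrite /pr fineK// fin_num_measure. Qed.

Lemma pr_setC A : measurable A -> pr (~` A) = (1 - pr A)%R.
Proof. by move=> mA; rewrite /pr probability_setC// (prE mA). Qed.

Lemma pr_le A B : measurable A -> measurable B -> A `<=` B -> (pr A <= pr B)%R.
Proof.
by move=> mA mB AB; rewrite -lee_fin -!prE//; apply: le_measure; rewrite ?inE.
Qed.

Lemma pr_ge0 A : (0 <= pr A)%R.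
Proof. exact: fine_ge0. Qed.

Lemma pr_setU A B : measurable A -> measurable B -> (pr (A `|` B) <= pr A + pr B)%R.
Proof.
move=> mA mB; rewrite -lee_fin EFinD -(prE mA) -(prE mB) -(prE (measurableU _ _ mA mB)).
exact: measureU2.
Qed.

Lemma pr_bigcup_gt F r : (forall n, measurable (F n)) ->
  (forall n m, (n <= m)%N -> F n `<=` F m) -> (r < pr (\bigcup_n F n))%R ->
  exists n, (r < pr (F n))%R.
Proof.
move=> mF iF; have mU : measurable (\bigcup_n F n) by exact: bigcup_measurable.
have cF := @nondecreasing_cvg_mu _ _ _ P F mF mU (fun n m h => introT (subsetPset _ _) (iF n m h)).
move=> rU; apply: contrapT => /forallNP h.
suff : (P (\bigcup_n F n) <= r%:E)%E by rewrite (prE mU) lee_fin leNgt rU.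
rewrite -(cvg_lim _ cF)//; apply: lime_le; first by apply/cvg_ex; exists (P (\bigcup_n F n)).
by apply: nearW => n /=; rewrite prE// lee_fin leNgt; exact/negP/h.
Qed.

Lemma pr_gt0_bigcup A F : (forall n, measurable (F n)) -> measurable A ->
  A `<=` \bigcup_n F n -> (0 < pr A)%R -> exists n, (0 < pr (A `&` F n))%R.
Proof.
move=> mF mA AF A0; apply: contrapT => /forallNP h.
suff : P A = 0%E by rewrite prE// => -[A0']; rewrite A0' ltxx in A0.
apply: measure_negligible => //.
have h0 k : P.-negligible (A `&` F k).
  have mAF : measurable (A `&` F k) by exact: measurableI.
  suff AF0 : P (A `&` F k) = 0%E by exact/negligibleP.
  rewrite prE//; congr EFin; apply/eqP; rewrite eq_le pr_ge0 leNgt andbT.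
  exact/negP/h.
apply: negligibleS (negligible_bigcup h0) => t At; have [n _ Fn] := AF t At; by exists n.
Qed.

End RealProbability.

(** * Semicontinuity of a parametrised law *)

Section Kernel.
Context d (T : measurableType d) (R : realType) (P : probability T R).

Lemma measurable_preimage_Borel (f : T -> Zomega) :
  (forall n v, measurable [set u | f u n = v]) ->
  forall S, Borel S -> measurable (f @^-1` S).
Proof.
move=> mf; apply: smallest_sub.
  split=> [|S mS|F mF]; first by rewrite preimage_set0; exact: measurable0.
    by rewrite setTD preimage_setC; exact: measurableC.
  by rewrite preimage_bigcup; exact: bigcup_measurable.
move=> S oS; rewrite (open_bigcup_basic oS) preimage_bigcup.
apply: bigcup_measurable => k _; rewrite /basic; case: (unpickle k) => [s|]; last first.
  by rewrite preimage_set0; exact: measurable0.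
rewrite (_ : _ @^-1` _ = ~` \bigcup_(i in `I_(size s)) ~` [set u | f u i = nth 0%R s i]).
  by apply/measurableC/bigcup_measurable => i _; exact/measurableC/mf.
rewrite setC_bigcup; under eq_bigcapr do rewrite setCK.
apply/seteqP; split=> [u /= fu i /= ni|u fu].
  by rewrite -[in RHS]fu nth_mkseq.
apply: (@eq_from_nth _ 0%R); rewrite size_mkseq// => i ni.
by rewrite nth_mkseq//; exact: fu.
Qed.

Variable phi : Zomega -> T -> Zomega.
Hypothesis phi_local : forall n (x x' : Zomega), (forall i, (i < n)%N -> x' i = x i) ->
  forall u i, (i < n)%N -> phi x' u i = phi x u i.
Hypothesis phi_meas : forall x n v, measurable [set u | phi x u n = v].

Definition kappa x (S : set Zomega) : R := pr P (phi x @^-1` S).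

Let mphi x S : Borel S -> measurable (phi x @^-1` S).
Proof. exact/measurable_preimage_Borel/phi_meas. Qed.

(** By continuity from below, the bound is already exceeded on the points whose prefix of some
    length [n] forces membership in [S]. By locality that event depends only on the first [n]
    coordinates of [x]. *)
Lemma open_kappa S r : open S -> open [set x | (r < kappa x S)%R].
Proof.
move=> oS; pose F n := [set z | cyl (prefix z n) `<=` S].
have oF n : open (F n) := open_prefix n [set s | cyl s `<=` S].
have mF x n : measurable (phi x @^-1` F n) by apply/mphi; exact: sub_gen_smallest.
have FE : S = \bigcup_n F n.
  apply/seteqP; split=> [z Sz|z [n _ /(_ z (cyl_prefix z n))]//].
  have /open_prefixP/(_ z Sz)[n hn] := oS.
  by exists n => // z'; rewrite /cyl /= size_mkseq => /eq_prefix/hn.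
have kE x : kappa x S = pr P (\bigcup_n (phi x @^-1` F n)).
  by rewrite -preimage_bigcup -FE.
apply/open_prefixP => x /=; rewrite kE.
have iF n m : (n <= m)%N -> phi x @^-1` F n `<=` phi x @^-1` F m.
  move=> nm u; rewrite /F /= => h z hz; apply: h; move: hz; rewrite /cyl /= !size_mkseq.
  by move=> /eq_prefix hz; apply/eq_prefix => i ni; apply: hz; exact: leq_trans nm.
move=> /(pr_bigcup_gt (mF x) iF)[n hn]; exists n => x' xx'.
apply: lt_le_trans hn _; apply: pr_le => //; first by apply/mphi; exact: sub_gen_smallest.
move=> u /= h; rewrite FE; exists n => //; rewrite /F /=.
suff -> : prefix (phi x' u) n = prefix (phi x u) n by [].
by apply/eq_prefix => i; exact: phi_local.
Qed.

(** The measure exceeds [r] exactly when some [G N] has measure at least [r + 1/(k+1)] for some [k].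
    This inequality is not strict, so it negates a strict one about the complement of [G N], to
    which the induction hypothesis applies. *)
Lemma Sigma0_kappa xi S r : Sigma0 xi S -> Sigma0 xi [set x | (r < kappa x S)%R].
Proof.
elim/(well_founded_ind olt_wf): xi S r => xi IH S r hS.
have [x1|x1] := ole_or_olt xi oone.
  apply: Sigma0_open; first exact: Sigma0_ole_oone hS.
  by apply: open_kappa; exact: Sigma0_oone hS.
have /(Sigma0P _ x1)[B hB SE] := hS.
have mB n : Borel (B n) by have [eta _ /Sigma0_Borel] := hB n.
(* Finite unions of the pieces are increasing, as continuity from below requires, and their
   complements are still of lower class. *)
pose G N := ~` \big[setI/setT]_(i < N.+1) B i.
have hG N : exists2 eta, olt eta xi & Sigma0 eta (~` G N).
  rewrite /G setCK; elim: N.+1 => [|n [eta ex h]].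
    by exists oone; rewrite ?big_ord0//; exact/Sigma0T/ole_refl.
  by rewrite big_ord_recr /=; apply: Sigma0_ltI => //; exists eta.
have mG N : Borel (~` G N) by have [eta _ /Sigma0_Borel] := hG N.
have GE : S = \bigcup_N G N.
  rewrite SE -(bigcup_bigsetU_bigcup (fun n => ~` B n)); apply: eq_bigcupr => N _.
  by rewrite /G; elim/big_rec2: _ => [|i x y _ ->]; rewrite ?setCT// setCI.
have iG n m : (n <= m)%N -> G n `<=` G m.
  move=> nm; apply: subsetC; rewrite -!bigcap_mkord => z h i /= im.
  by apply: h => /=; exact: leq_trans nm.
have mphiG x N : measurable (phi x @^-1` G N).
  by apply: mphi; rewrite -(setCK (G N)); exact: Borel_setC.
rewrite (_ : [set x | _] = \bigcup_p ~` (if unpickle p is Some (N, k) then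
    [set x | (1 - (r + k.+1%:R^-1) < kappa x (~` G N))%R] else setT)).
  apply: Sigma0_bigcupC => p; case: (unpickle p) => [[N k]|].
    by have [eta ex /(IH _ ex)] := hG N; exists eta.
  by exists oone => //; exact/Sigma0T/ole_refl.
have kG x N : kappa x (~` G N) = (1 - kappa x (G N))%R.
  by rewrite /kappa -[_ @^-1` _]/(~` (phi x @^-1` G N)) pr_setC.
apply/seteqP; split=> x /=.
  rewrite {1}/kappa {1}GE preimage_bigcup => /(pr_bigcup_gt (mphiG x)).
  case=> [n m nm u|N rN]; first exact: iG.
  have [k hk] := ltr_add_invr rN; exists (pickle (N, k)) => //; rewrite pickleK /= kG.
  apply/negP; rewrite -leNgt lerD2l lerN2; exact: ltW.
move=> [p _]; case: (unpickle p) => [[N k]|/(_ I)//] /=; rewrite kG => /negP.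
rewrite -leNgt lerD2l lerN2 => h; have : (r < kappa x (G N))%R.
  by apply: lt_le_trans h; rewrite ltrDl invr_gt0 ltr0n.
move=> /lt_le_trans; apply; apply: pr_le => //.
  by apply: mphi; exact: Sigma0_Borel hS.
by move=> u h'; rewrite /= GE; exists N.
Qed.

End Kernel.

(** * Selecting a point in a set of positive measure *)

(* [S i] is built from clopen sets by complemented countable unions, and [q] records
   how: the truth lemma below needs the very decomposition used for the decisions. *)
Inductive coded (S : nat -> set Zomega) (q : nat -> option (nat -> nat)) : nat -> Prop :=
| coded_clopen i : q i = None -> open (S i) -> open (~` S i) -> coded S q i
| coded_union i f : q i = Some f -> S i = \bigcup_j ~` S (f j) ->
    (forall j, coded S q (f j)) -> coded S q i.

(** * Countable systems of sets of lower class, closed under decomposition *)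

Section Coding.
Variable xi : cord.
Hypothesis xi1 : olt oone xi.

Definition low A := exists2 eta, olt eta xi & Sigma0 eta A.

Lemma open_low A : open A -> low A.
Proof. by move=> oA; exists oone => //; apply: Sigma0_open => //; exact: ole_refl. Qed.

(** The codings are placed side by side on codes of pairs; the other indices carry the empty set as
    a clopen leaf. *)
Lemma coding_merge (A : nat -> set Zomega) :
  (forall n, exists S q i, [/\ forall j, low (S j), forall j, coded S q j & S i = A n]) ->
  exists S q f, [/\ forall j, low (S j), forall j, coded S q j & forall n, S (f n) = A n].
Proof.
move=> h.
have /choice[c hc] : forall n, exists c : (nat -> set Zomega) *
    (nat -> option (nat -> nat)) * nat,
    [/\ forall j, low (c.1.1 j), forall j, coded c.1.1 c.1.2 j & c.1.1 c.2 = A n].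
  by move=> n; have [S [q [i ?]]] := h n; exists (S, q, i).
pose S p := if unpickle p is Some (n, i) then (c n).1.1 i else set0.
pose q p := if unpickle p is Some (n, i)
  then omap (fun f j => pickle (n, f j)) ((c n).1.2 i) else None.
have S0 p : @unpickle (nat * nat)%type p = None -> S p = set0 by rewrite /S => ->.
have hS p n i : unpickle p = Some (n, i) -> S p = (c n).1.1 i by rewrite /S => ->.
have hq p n i : unpickle p = Some (n, i) ->
    q p = omap (fun f j => pickle (n, f j)) ((c n).1.2 i) by rewrite /q => ->.
exists S, q, (fun n => pickle (n, (c n).2)); split=> [p|p|n].
- case E : (@unpickle (nat * nat)%type p) => [[n i]|].
    by rewrite (hS _ _ _ E); have [] := hc n.
  by rewrite (S0 _ E); exact/open_low/open0.
- case E : (@unpickle (nat * nat)%type p) => [[n i]|]; last first.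
    apply: coded_clopen; rewrite ?(S0 _ E) ?setC0; [|exact: open0|exact: openT].
    by rewrite /q E.
  have [_ /(_ i) + _] := hc n => ci; elim: ci p E => {}i.
    by move=> qi ? ? p E; apply: coded_clopen; rewrite ?(hS _ _ _ E) ?(hq _ _ _ E)// qi.
  move=> f qi Si _ IH p E; apply: (@coded_union _ _ _ (fun j => pickle (n, f j))).
  + by rewrite (hq _ _ _ E) qi.
  + rewrite (hS _ _ _ E) Si; apply: eq_bigcupr => j _.
    by rewrite (hS _ n (f j)) ?pickleK.
  + by move=> j; apply: IH; rewrite pickleK.
- by rewrite (hS _ n (c n).2) ?pickleK//; have [] := hc n.
Qed.

Lemma Sigma0_coding eta A : Sigma0 eta A -> olt eta xi ->
  exists S q i, [/\ forall j, low (S j), forall j, coded S q j & S i = A].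
Proof.
elim=> {eta A} [eta A _ oA _|eta e A ee hA IH ex].
  pose S p := if p is j.+1 then (if `[< basic j `<=` A >] then ~` basic j else setT) else A.
  pose q p : option (nat -> nat) := if p is 0 then Some succn else None.
  have cS j : coded S q j.+1.
    apply: coded_clopen => //=; case: ifP => _; [exact: open_setC_basic|exact: openT| |].
      by rewrite setCK; exact: open_basic.
    by rewrite setCT; exact: open0.
  exists S, q, 0; split=> // [] [|j] //=.
  - exact: open_low.
  - by have := cS j => h; inversion h => //; exact: open_low.
  apply: (@coded_union _ _ _ succn) => //=; rewrite {1}(open_bigcup_basic oA).
  apply/seteqP; split=> z [j].
    by move=> /= kA kz; exists j => //; rewrite asboolT//; apply.
  by move=> _; case: asboolP => [kA|_ /(_ I)//]; rewrite setCK => kz; exists j.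
have [n|S [q [f [lS cS hf]]]] := coding_merge (A := fun n => ~` A n).
  by apply: IH; apply: olt_ole_trans (ee n) (oltW ex).
pose S' p := if p is p'.+1 then S p' else \bigcup_n A n.
pose q' p := if p is p'.+1 then omap (fun g j => (g j).+1) (q p')
  else Some (fun n => (f n).+1).
have cS' j : coded S' q' j.+1.
  elim: (cS j) => {}j.
    by move=> qj ? ?; apply: coded_clopen => //=; rewrite qj.
  move=> g qj Sj _ h; apply: (@coded_union _ _ _ (fun j => (g j).+1)) => //=.
  by rewrite qj.
exists S', q', 0; split=> // [] [|j] //=.
  by exists eta => //; exact: (@Sigma0_union _ e).
apply: (@coded_union _ _ _ (fun n => (f n).+1)) => //=.
by apply: eq_bigcupr => n _; rewrite hf setCK.
Qed.

(** [W] itself need not be of lower class, so only the pieces of its decomposition enter the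
    system. *)
Lemma Sigma0_top_coding W : Sigma0 xi W -> exists S q (f : nat -> nat),
  [/\ forall j, low (S j), forall j, coded S q j & W = \bigcup_n ~` S (f n)].
Proof.
move=> /(Sigma0P _ xi1)[B hB ->]; have [n|S [q [f [lS cS hf]]]] := coding_merge (A := B).
  by have [eta ex /Sigma0_coding] := hB n; exact.
by exists S, q, f; split=> //; apply: eq_bigcupr => n _; rewrite hf.
Qed.

End Coding.

(** * Histories of least admissible decisions *)

Section History.
Context d (T : measurableType d) (R : realType) (P : probability T R).
Variable phi : Zomega -> T -> Zomega.
Hypothesis phi_local : forall n (x x' : Zomega), (forall i, (i < n)%N -> x' i = x i) ->
  forall u i, (i < n)%N -> phi x' u i = phi x u i.
Hypothesis phi_meas : forall x n v, measurable [set u | phi x u n = v].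
Variables (xi : cord) (O : nat -> nat -> set Zomega).
Hypothesis xi1 : olt oone xi.
Hypothesis O_low : forall n j, low xi (~` O n j).

Notation kap := (kappa P phi).

Definition choice_code (p : nat) : nat * nat := odflt (0, 0) (unpickle p).

Lemma choice_codeK : cancel pickle choice_code.
Proof. by move=> jk; rewrite /choice_code pickleK. Qed.

(* A history lists the latest decision first; the decision [p] codes the chosen
   alternative together with a witness [k] that its measure is at least [1/(k+1)]. *)
Fixpoint cell (u : seq nat) : set Zomega :=
  if u is p :: u' then O (size u') (choice_code p).1 `&` cell u' else setT.

Definition admissible u p : set Zomega :=
  [set x | ((choice_code p).2.+1%:R^-1 <= kap x (cell (p :: u)))%R].

Fixpoint history (u : seq nat) : set Zomega :=
  if u is p :: u' then history u' `&` admissible u' p `&`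
    \bigcap_(p' in `I_p) ~` admissible u' p' else setT.

Lemma low_setC_cell u : low xi (~` cell u).
Proof.
elim: u => [|p u IH] /=; first by rewrite setCT; apply: open_low => //; exact: open0.
by rewrite setCI; exact: Sigma0_ltU (O_low _ _) IH.
Qed.

Lemma Borel_cell u : Borel (cell u).
Proof.
by rewrite -(setCK (cell u)); have [eta _ /Sigma0_Borel/Borel_setC] := low_setC_cell u.
Qed.

Let mphi x S : Borel S -> measurable (phi x @^-1` S).
Proof. exact/measurable_preimage_Borel/phi_meas. Qed.

Lemma kappa_setC x S : Borel S -> kap x (~` S) = (1 - kap x S)%R.
Proof. by move=> bS; rewrite /kappa -[_ @^-1` _]/(~` (phi x @^-1` S)) pr_setC//; exact: mphi. Qed.

(** Here the explicit lower bound [1/(k+1)] pays off: its failure is a strict inequality about the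
    complement of a cell, which is of lower class, whereas plain positivity would cost a level. *)
Lemma low_setC_admissible u p : low xi (~` admissible u p).
Proof.
have [eta ex h] := low_setC_cell (p :: u).
exists eta => //; rewrite (_ : ~` _ =
  [set x | (1 - (choice_code p).2.+1%:R^-1 < kap x (~` cell (p :: u)))%R]).
  exact: (Sigma0_kappa P phi_local phi_meas _ h).
apply/seteqP; split=> x; rewrite /= kappa_setC; try exact: Borel_cell (p :: u).
  by move=> /negP; rewrite -ltNge ltrD2l ltrN2.
by rewrite ltrD2l ltrN2 => h'; apply/negP; rewrite -ltNge.
Qed.

(** A history is a finite Boolean combination of admissibility sets, whose complements are of lower
    class. *)
Lemma Sigma0_history u : Sigma0 xi (history u) /\ Sigma0 xi (~` history u).
Proof.
have x1 : ole oone xi by exact: oltW.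
elim: u => [|p u [IH IHC]] /=.
  by rewrite setCT; split; [exact: Sigma0T x1|exact: Sigma00 x1].
rewrite !setCI; split.
  apply: Sigma0I; first apply: Sigma0I => //.
    have [eta ex h] := low_setC_admissible u p.
    by rewrite -(setCK (admissible u p)); exact: Sigma0_setC_lt h.
  elim: p => [|p IHp]; first by rewrite II0 bigcap_set0; exact: Sigma0T.
  rewrite IIS bigcap_setU bigcap_set1; apply: Sigma0I => //.
  by have [eta ex] := low_setC_admissible u p; exact: Sigma0_lt.
apply: Sigma0U; first apply: Sigma0U => //.
  by have [eta ex] := low_setC_admissible u p; exact: Sigma0_lt.
rewrite setC_bigcap bigcup_mkcond; apply: Sigma0_bigcup => i; case: ifP => _.
  have [eta ex h] := low_setC_admissible u i.
  exact: Sigma0_setC_lt h.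
exact: Sigma00 x1.
Qed.

Lemma history_uniq x u u' : size u = size u' -> history u x -> history u' x -> u = u'.
Proof.
elim: u u' => [|p u IH] [|p' u'] //= [/IH{}IH] [[/IH + hp] hp2] [[+ hp'] hp'2] => h h'.
rewrite -(h h') in hp' hp'2 *.
have [pp|pp|->//] := ltngtP p p'; first by have := hp'2 p pp.
by have := hp2 p' pp.
Qed.

Lemma history_pos x p u : history (p :: u) x -> (0 < kap x (cell (p :: u)))%R.
Proof. by move=> [[_ /= h] _]; apply: lt_le_trans h; rewrite invr_gt0 ltr0n. Qed.

Lemma history_extend x u : history u x ->
  (exists j, 0 < kap x (O (size u) j `&` cell u))%R -> exists p, history (p :: u) x.
Proof.
move=> hu [j j0]; have [k hk] := ltr_add_invr j0.
have adm : exists p, `[< admissible u p x >].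
  (* The witness [k] comes from the positive measure of alternative [j] exceeding [1/(k+1)]. *)
  exists (pickle (j, k)); apply/asboolP; rewrite /admissible /= choice_codeK.
  by apply: ltW; rewrite add0r in hk.
case: (ex_minnP adm) => p /asboolP hp hmin; exists p; split=> // p' /= pp' hp'.
by have := hmin p'; rewrite asboolT// leqNgt pp' => /(_ isT).
Qed.

Hypothesis O_cover : forall n, \bigcup_j O n.+1 j = setT.

(** From decision 1 on the alternatives cover the space, so one of them meets the current cell in
    positive measure. Nothing similar is assumed of decision 0, hence the hypothesis on a first
    decision. *)
Lemma history_total x p n : history [:: p] x -> exists2 u, size u = n & history u x.
Proof.
move=> hp; case: n => [|n]; first by exists [::].
elim: n => [|n [[|q u]// un hu]]; first by exists [:: p].
have mO j : measurable (phi x @^-1` O n.+1 j).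
  by apply: mphi; rewrite -(setCK (O _ _)); have [eta _ /Sigma0_Borel/Borel_setC] := O_low n.+1 j.
have [] := @history_extend x (q :: u) hu;
  last by move=> p' hp'; exists (p' :: q :: u); rewrite //= -un.
have [] := pr_gt0_bigcup mO (mphi x (Borel_cell (q :: u))) _ (history_pos hu).
  by move=> t _; have : setT (phi x t) by []; rewrite -(O_cover n) => -[j _]; exists j.
by move=> j; rewrite un => h; exists j; rewrite /kappa preimage_setI setIC.
Qed.

End History.

(** * The selected point and its truth lemma *)

Section Selection.
Context d (T : measurableType d) (R : realType) (P : probability T R).
Variable phi : Zomega -> T -> Zomega.
Hypothesis phi_local : forall n (x x' : Zomega), (forall i, (i < n)%N -> x' i = x i) ->
  forall u i, (i < n)%N -> phi x' u i = phi x u i.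
Hypothesis phi_meas : forall x n v, measurable [set u | phi x u n = v].
Variable rho : Zomega -> Zomega.
Hypothesis rho_local : forall n (z z' : Zomega), (forall i, (i < n.*2)%N -> z' i = z i) ->
  forall i, (i < n)%N -> rho z' i = rho z i.
Hypothesis rho_phi : forall z u, rho (phi (rho z) u) = rho z.

Lemma open_preimage_rho B : open B -> open (rho @^-1` B).
Proof.
move=> /open_prefixP oB; apply/open_prefixP => z /oB[n hn].
by exists n.*2 => z' zz'; apply: hn => i; exact: rho_local.
Qed.

Lemma kappa_inhabited x S : (0 < kappa P phi x S)%R -> exists u, S (phi x u).
Proof.
move=> k0; apply: contrapT => /forallNP h; move: k0.
by rewrite /kappa (_ : _ @^-1` _ = set0) ?/pr ?measure0 ?ltxx//; apply/seteqP; split.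
Qed.

(* Decision [0] puts the point in [W = \bigcup_j ~` S (f j)], decision [2i+1] fixes
   its coordinate [i], and decision [2i+2] settles whether it lies in [S i]: either
   it does not (alternative [0]) or it avoids one of the sets [S (g j)]. *)
Definition requirement (S : nat -> set Zomega) (q : nat -> option (nat -> nat))
    (f : nat -> nat) (n j : nat) : set Zomega :=
  if n is n'.+1 then
    if odd n' then
      if q n'./2 is Some g then ~` S (if j is j'.+1 then g j' else n'./2) else setT
    else [set z | unpickle j = Some (z n'./2)]
  else ~` S (f j).

Section Truth.
Variables (xi : cord) (S : nat -> set Zomega) (q : nat -> option (nat -> nat)) (f : nat -> nat).
Hypothesis xi1 : olt oone xi.
Hypothesis S_low : forall i, low xi (S i).
Hypothesis S_coded : forall i, coded S q i.

Notation O := (requirement S q f).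
Notation hist := (history P phi O).

Lemma requirement_low n j : low xi (~` O n j).
Proof.
case: n => [|n] /=; first by rewrite setCK.
case: ifP => _; last first.
  apply: open_low => //; exact: (open_coordinate n./2 (fun v => unpickle j <> Some v)).
by case: (q _) => [g|]; [rewrite setCK|rewrite setCT; apply: open_low => //; exact: open0].
Qed.

Lemma requirement_cover n : \bigcup_j O n.+1 j = setT.
Proof.
apply/seteqP; split=> // z _ /=; case: (odd n); last first.
  by exists (pickle (z n./2 : int)) => //=; rewrite pickleK.
case: (S_coded n./2) => [i -> _ _|i g -> SE _]; first by exists 0.
have [zS|zS] := pselect (S i z); last by exists 0.
by move: zS; rewrite SE => -[j _ zS]; exists j.+1.
Qed.

Section Branch.
Variables (x : Zomega) (h : nat -> seq nat).
Hypothesis x_rho : exists z, x = rho z.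
Hypothesis size_h : forall n, size (h n) = n.
Hypothesis hist_h : forall n, hist (h n) x.

Lemma branchS n : h n.+1 = head 0 (h n.+1) :: h n.
Proof.
have := size_h n.+1; have := hist_h n.+1; case: (h n.+1) => // p u [[hu _] _] [un] /=.
by congr cons; apply: (history_uniq _ hu (hist_h n)); rewrite size_h.
Qed.

Lemma cell_branch m n : (m <= n)%N -> cell O (h n) `<=` cell O (h m).
Proof.
move=> /subnKC <-; elim: (n - m)%N => [|k IH]; first by rewrite addn0.
by rewrite addnS branchS /= => z [_ /IH].
Qed.

Definition branch_choice n := (choice_code (head 0 (h n.+1))).1.

Lemma cell_branchS n : cell O (h n.+1) `<=` O n (branch_choice n).
Proof. by rewrite branchS /= size_h => z []. Qed.

(** Positive measure yields a point of the form [phi x u], and such points lie over [x] because [x]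
    is a value of [rho]. *)
Lemma branch_inhabited n : exists y, rho y = x /\ cell O (h n) y.
Proof.
have [u hu] : exists u, cell O (h n.+1) (phi x u).
  by apply: kappa_inhabited; move: (hist_h n.+1); rewrite branchS; exact: history_pos.
exists (phi x u); split; first by have [z ->] := x_rho; exact: rho_phi.
exact: cell_branch hu.
Qed.

Definition branch_point : Zomega := fun i => odflt 0%R (unpickle (branch_choice i.*2.+1)).

Lemma cell_coordinate n i y : (i < n)%N -> cell O (h n.*2) y -> y i = branch_point i.
Proof.
move=> ni /(cell_branch (m := i.*2.+2)) h'.
have /cell_branchS /= : cell O (h i.*2.+2) y by apply: h'; rewrite -doubleS leq_double.
by rewrite odd_double /branch_point doubleK => ->.
Qed.

(** Coordinate [i] of [rho] depends on the first [2(i+1)] coordinates only, and a history of length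
    [4(i+1)] makes these agree with those of a point over [x]. *)
Lemma rho_branch_point : rho branch_point = x.
Proof.
apply: funext => i; have [y [<- hy]] := branch_inhabited i.+1.*2.*2.
by apply: (@rho_local i.+1) => // j hj; rewrite (cell_coordinate hj hy).
Qed.

(** What a cell forces holds at the limit point. On a clopen leaf, a small enough cell decides
    membership as the limit point does, and any two cells of the branch meet. On a union, decision
    [2i+2] supplies the piece to which the induction hypothesis applies. *)
Lemma truth i :
  ((exists n, cell O (h n) `<=` S i) -> S i branch_point) /\
  ((exists n, cell O (h n) `<=` ~` S i) -> ~ S i branch_point).
Proof.
have meet m n : exists y, cell O (h m) y /\ cell O (h n) y.
  have [y [_ hy]] := branch_inhabited (maxn m n).
  by exists y; split; apply: cell_branch hy; rewrite ?leq_maxl ?leq_maxr.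
have germ C : open C -> C branch_point -> exists n, cell O (h n) `<=` C.
  move=> /open_prefixP oC /oC[n hn]; exists n.*2 => y hy.
  by apply: hn => j jn; exact: cell_coordinate hy.
elim: (S_coded i) => {}i.
  move=> _ oS oSC; split=> [[n hn]|[n hn] Si]; first apply: contrapT => Si.
    by have [m hm] := germ _ oSC Si; have [y [/hm ? /hn]] := meet m n.
  by have [m hm] := germ _ oS Si; have [y [/hm ? /hn]] := meet m n.
move=> g qi SE _ IH; split=> [[n hn]|[n hn]].
  rewrite SE; pose j := branch_choice i.*2.+2.
  have hm : cell O (h i.*2.+3) `<=` ~` S (if j is j'.+1 then g j' else i).
    move=> y /cell_branchS; rewrite /requirement /= odd_double /= uphalf_double qi.
    exact.
  (* Alternative 0 would put a cell outside [S i], against the cell contained in [S i]. *)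
  move: hm; case: j => [hm|j hm].
    by have [y [/hn ? /hm]] := meet n i.*2.+3.
  by exists j => //; apply: (IH j).2; exists i.*2.+3.
rewrite SE => -[j _]; apply; apply: (IH j).1; exists n => y /hn.
by rewrite SE => yS; apply: contrapT => yj; apply: yS; exists j.
Qed.

(** Coordinate decisions hold by the definition of the point; all the others assert that some coded
    set is avoided, and pass to the limit by [truth]. *)
Lemma branch_point_requirement n : O n (branch_choice n) branch_point.
Proof.
have cS := @cell_branchS n; case: n cS => [|n] /= cS.
  by apply: (truth _).2; exists 1.
move: cS; case: ifP => [on|en].
  case: (q _) => // g cS; apply: (truth _).2.
  by exists n.+2.
move=> _; have [y [_ hy]] := branch_inhabited n.+2.
have := cell_branchS hy => /=; rewrite en => E.
have n2 : n = n./2.*2 by rewrite -[LHS]odd_double_half en.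
by rewrite /branch_point -n2 E.
Qed.

Lemma cell_branch_point n : cell O (h n) branch_point.
Proof.
elim: n => [|n IH]; first by have := size_h 0; case: (h 0).
rewrite branchS /=; split=> //; rewrite size_h; exact: branch_point_requirement.
Qed.

End Branch.
End Truth.

(** Over one parameter the histories settle every coordinate, which gives uniqueness; existence is
    the limit point of the branch of histories. *)
Lemma selection xi W : olt oone xi -> Sigma0 xi W -> exists A B, [/\ Pi0 xi A, Pi0 xi B,
    forall z z', (A `\` B) z -> (A `\` B) z' -> rho z = rho z' -> z = z' &
    forall x, (exists z, x = rho z) -> (0 < kappa P phi x W)%R ->
      exists z, [/\ (A `\` B) z, rho z = x & W z]].
Proof.
move=> xi1 /(Sigma0_top_coding xi1)[S [q [f [lS cS WE]]]].
pose O := requirement S q f; pose hist := history P phi O.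
have lO := requirement_low q f xi1 lS : forall n j, low xi (~` O n j).
have cO := requirement_cover f cS : forall n, \bigcup_j O n.+1 j = setT.
have s_hist u : Sigma0 xi (hist u) /\ Sigma0 xi (~` hist u).
  exact: (Sigma0_history P phi_local phi_meas xi1 lO u).
have s_cell u : Sigma0 xi (~` cell O u).
  by have [eta ex] := low_setC_cell xi1 lO u; exact: Sigma0_lt.
pose D (c : option (seq nat)) :=
  if c is Some u then rho @^-1` hist u `&` ~` cell O u else set0.
have s_D c : Sigma0 xi (D c).
  case: c => [u|]; last by apply: Sigma00; exact: oltW.
  apply: Sigma0I => //; apply: Sigma0_preimage open_preimage_rho _.
  exact: (s_hist u).1.
(* [A] says that [z] obeys every history valid at [rho z], and [B] that no first decision is
   admissible there. *)
pose A := ~` \bigcup_k D (unpickle k).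
pose B := ~` (rho @^-1` \bigcup_p hist [:: p]).
have EP z : (A `\` B) z <-> (exists p, hist [:: p] (rho z)) /\
    (forall u, hist u (rho z) -> cell O u z).
  split=> [[Az /contrapT[p _ hp]]|[[p hp] hz]].
    split=> [|u hu]; first by exists p.
    apply: contrapT => cu; apply: Az; exists (pickle u) => //.
    by rewrite pickleK.
  split=> [[k _]|]; last by apply; exists p.
  by case: (unpickle k) => // u [/hz].
exists A, B; split.
- by rewrite /Pi0 setCK; apply: Sigma0_bigcup => k.
- rewrite /Pi0 setCK; apply: Sigma0_preimage open_preimage_rho _.
  by apply: Sigma0_bigcup => p; exact: (s_hist _).1.
- move=> z z' /EP[[p hp] hz] /EP[_ hz'] zz'; apply: funext => i.
  (* Length [2i+2] is the first that includes decision [2i+1], which fixes coordinate [i]. *)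
  have [u su hu] := history_total phi_meas xi1 lO cO i.*2.+2 hp.
  have := hz u hu; rewrite zz' in hu; have := hz' u hu.
  case: u su hu => [//|p' u] [su] _ [+ _] [+ _].
  by rewrite su /O /requirement odd_double doubleK => /= -> [].
move=> x xr xW.
have W0 : W = \bigcup_j O 0 j by [].
have mO j : measurable (phi x @^-1` O 0 j).
  apply: (measurable_preimage_Borel (phi_meas x)).
  by have [eta _ /Sigma0_Borel/Borel_setC] := lO 0 j; rewrite setCK.
have [p hp] : exists p, hist [:: p] x.
  apply: (@history_extend _ _ _ P phi O x [::]) => //=.
  have [|||j hj] := @pr_gt0_bigcup _ _ _ P (phi x @^-1` W) (fun j => phi x @^-1` O 0 j) mO.
  - rewrite W0 preimage_bigcup; exact: bigcup_measurable.
  - by rewrite W0 preimage_bigcup.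
  - exact: xW.
  exists j; rewrite setIT /kappa.
  by rewrite setIidr// in hj => t ?; rewrite /= W0; exists j.
have /choice[h hh] : forall n, exists u, size u = n /\ hist u x.
  by move=> n; have [u ? ?] := history_total phi_meas xi1 lO cO n hp; exists u.
have size_h n : size (h n) = n by have [] := hh n.
have hist_h n : hist (h n) x by have [] := hh n.
have zx := @rho_branch_point S q f x h xr size_h hist_h.
exists (branch_point h); split=> //; last first.
  rewrite W0; exists (branch_choice h 0) => //.
  exact: (@branch_point_requirement S q f cS x h xr size_h hist_h 0).
apply/EP; rewrite zx; split=> [|u hu]; first by exists p.
rewrite -(history_uniq (size_h (size u)) (hist_h _) hu).
exact: (@cell_branch_point S q f cS x h xr size_h hist_h).
Qed.

End Selection.

(** * The parametrisation and the laws it codes *)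

Lemma measurable_fun_borelZ d (T : measurableType d) (f : T -> Zomega) :
  (forall n v, measurable [set u | f u n = v]) -> measurable_fun setT (f : T -> borelZ).
Proof. by move=> mf _ Y mY; rewrite setTI; exact: measurable_preimage_Borel mf _ mY. Qed.

Lemma pushforward_probability d (T : measurableType d) (R : realType) (P : probability T R)
    (f : T -> Zomega) : (forall n v, measurable [set u | f u n = v]) ->
  exists mu : probability borelZ R, forall A, mu A = P (f @^-1` A).
Proof.
move=> /measurable_fun_borelZ mf.
pose X : {mfun T >-> borelZ} := HB.pack f (isMeasurableFun.Build _ _ _ _ (f : T -> borelZ) mf).
by exists (distribution P X).
Qed.

(** * The uniform law and integer step functions *)

Section Uniform.
Variable R : realType.

Definition unif : probability _ R := uniform_prob (@ltr01 R).

Lemma unifE (A : set R) : measurable A ->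
  unif A = lebesgue_measure (A `&` `[0%R, 1%R]).
Proof.
move=> mA; rewrite /unif /= /uniform_prob integral_uniform_pdf.
rewrite (eq_integral (cst 1%E)); last first.
  by move=> x; rewrite inE /= in_itv /= => -[_ x01]; rewrite /uniform_pdf x01 subr0 invr1.
by rewrite integral_cst ?mul1e//; exact: measurableI.
Qed.

Lemma unif_itv (a b : R) : (0 <= a)%R -> (a <= b)%R -> (b <= 1)%R ->
  unif `[a, b[ = (b - a)%:E.
Proof.
move=> a0 ab b1; rewrite unifE//.
rewrite (_ : _ `&` _ = `[a, b[); last first.
  apply: setIidl => x; rewrite /= !in_itv /= => /andP[ax xb].
  by rewrite (le_trans a0 ax) (ltW (lt_le_trans xb b1)).
by rewrite lebesgue_measure_itv /= lte_fin; case: ltgtP ab => // -> _; rewrite subrr.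
Qed.

Lemma unif1 (a : R) : unif [set a] = 0%E.
Proof.
apply/eqP; rewrite eq_le measure_ge0 andbT unifE//.
by rewrite -(lebesgue_measure_set1 a) le_measure// inE//; exact: measurableI.
Qed.

(** Presented by a finite list of integers, a step function is a datum that one coordinate of a
    parameter can code. *)
Definition step (l : seq int) (u : R) : int := nth 0%R l (Num.truncn (u * (size l)%:R)%R).

Lemma measurable_truncn (c : R) (Q : nat -> Prop) :
  measurable [set u : R | Q (Num.truncn (u * c)%R)].
Proof.
rewrite (_ : [set u | _] = \bigcup_(k in Q) [set u | Num.truncn (u * c)%R = k]); last first.
  apply/seteqP; split=> [u Qu|u [k Qk /= uk]]; last by rewrite /= uk.
  by exists (Num.truncn (u * c)%R).
apply: bigcup_measurable => k _.
have ms n : measurable [set u : R | (u * c < n%:R)%R].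
  have mc : measurable_fun setT (fun u : R => u * c)%R by exact: mulrr_measurable.
  have := mc measurableT _ (measurable_itv `]-oo, (n%:R)%R[%R); rewrite setTI.
  by congr measurable; apply/seteqP; split=> u; rewrite /= in_itv.
case: k => [|k].
  rewrite (_ : [set u | _] = [set u : R | (u * c < 1%:R)%R])//.
  apply/seteqP; split=> u /=.
    by move=> h; rewrite -truncn_le_nat h.
  by rewrite -truncn_le_nat leqn0 => /eqP.
rewrite (_ : [set u | _] = [set u : R | (u * c < k.+2%:R)%R] `\` [set u | (u * c < k.+1%:R)%R]).
  exact: measurableD.
apply/seteqP; split=> u /=; rewrite -!truncn_le_nat.
  by move=> ->; rewrite leqnn ltnn.
by move=> [h /negP]; rewrite -ltnNge => h'; apply/eqP; rewrite eqn_leq h.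
Qed.

Lemma measurable_step l (v : int) : measurable [set u | step l u = v].
Proof. exact: (measurable_truncn _ (fun k => nth 0%R l k = v)). Qed.

End Uniform.

(* A parameter codes the step functions of coordinates [2i] and [2i+1], and the
   [i]-th entry of the code of a Sigma^0_xi set. *)
Definition param (m : nat) : seq int * seq int * nat := odflt ([::], [::], 0) (unpickle m).

Lemma paramK : cancel pickle param.
Proof. by move=> p; rewrite /param pickleK. Qed.

Definition radius m := \max_(v <- (param m).1.1) absz v.

Definition offset m := \sum_(j < m) (radius j).*2.+1.

Definition center m : int := Posz (offset m + radius m).

(** A block has exactly the length needed for [center m] plus any integer of absolute value at most
    [radius m]. Integers in no block, such as the negative ones, get the default 0. *)
Definition decode (v : int) : nat :=
  xget 0 [set m | exists k, v = Posz k /\ (offset m <= k < offset m.+1)%N].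

Lemma offsetS m : offset m.+1 = offset m + (radius m).*2.+1.
Proof. by rewrite /offset big_ord_recr. Qed.

Lemma leq_offset m n : (m <= n)%N -> (offset m <= offset n)%N.
Proof.
move=> /subnKC <-; elim: (n - m) => [|k IH]; first by rewrite addn0.
by rewrite addnS offsetS (leq_trans IH)// leq_addr.
Qed.

Lemma decode_center m (w : int) : (absz w <= radius m)%N -> decode (center m + w)%R = m.
Proof.
move=> wm; have [k [kE km]] : exists k, (center m + w)%R = Posz k /\
    (offset m <= k < offset m.+1)%N.
  exists (absz (center m + w)%R); rewrite offsetS /center; split; lia.
rewrite /decode; set D := [set _ | _]; move: (xget 0 D) (@xgetPex _ 0 D).
move=> m' [|k' []]; first by exists m, k.
rewrite kE => -[<-] /andP[mk' km']; case/andP: km => mk km.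
have [/leq_offset mm|/leq_offset mm|//] := ltngtP m m'.
  by have := leq_trans km (leq_trans mm mk'); rewrite ltnn.
by have := leq_trans km' (leq_trans mm mk); rewrite ltnn.
Qed.

Lemma absz_step_radius (R : realType) m (u : R) : (absz (step (param m).1.1 u) <= radius m)%N.
Proof.
rewrite /step /radius; set l := (param m).1.1; set k := Num.truncn _.
have [kl|kl] := ltnP k (size l); last by rewrite nth_default.
by apply: (@leq_bigmax_seq _ _ xpredT absz) => //; exact: mem_nth.
Qed.

Definition rho (z : Zomega) : Zomega := fun i => Posz (decode (z i.*2)).

(** Even coordinates stay in the block of their parameter, which keeps the law on one fibre of
    [rho]. Taking [absz] loses nothing on values of [rho], which are nonnegative. *)
Definition phi (R : realType) (x : Zomega) (u : R) : Zomega := fun i =>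
  if odd i then step (param (absz (x i./2))).1.2 u
  else (center (absz (x i./2)) + step (param (absz (x i./2))).1.1 u)%R.

Lemma rho_local n (z z' : Zomega) : (forall i, (i < n.*2)%N -> z' i = z i) ->
  forall i, (i < n)%N -> rho z' i = rho z i.
Proof. by move=> h i ni; rewrite /rho h// ltn_double. Qed.

Section Phi.
Variable R : realType.

Lemma rho_phi z (u : R) : rho (phi (rho z) u) = rho z.
Proof.
apply: funext => i; rewrite /rho; congr Posz.
by rewrite {1}/phi odd_double doubleK; exact/decode_center/absz_step_radius.
Qed.

Lemma phi_local n (x x' : Zomega) : (forall i, (i < n)%N -> x' i = x i) ->
  forall (u : R) i, (i < n)%N -> phi x' u i = phi x u i.
Proof. by move=> h u i ni; rewrite /phi h//; lia. Qed.

Lemma phi_meas x n (v : int) : measurable [set u : R | phi x u n = v].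
Proof.
rewrite /phi; case: (odd n); first exact: measurable_step.
rewrite (_ : [set u | _] =
  [set u | step (param (absz (x n./2))).1.1 u = v - center (absz (x n./2))]%R).
  exact: measurable_step.
apply/seteqP; split=> u /=; first by move=> <-; rewrite addrC addKr.
by move=> ->; rewrite addrC subrK.
Qed.

(* The witness lives on the odd coordinates and comes from a map that is injective
   on the line, so that each translate of [E] pulls back to at most one point. *)
Lemma rho_HaarNull E : Borel E ->
  (forall z z', E z -> E z' -> rho z = rho z' -> z = z') -> HaarNull R E.
Proof.
move=> bE inj; exists E; split=> //.
pose zeta (u : R) : Zomega := fun i => if odd i then Num.floor (u * i%:R)%R else 0%R.
have zeta_inj u u' : zeta u = zeta u' -> u = u'.
  wlog uu' : u u' / (u < u')%R => [hw zz|zz].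
    by have [/hw|/hw h|//] := ltgtP u u'; [exact|apply/esym/h].
  have d0 : (0 < u' - u)%R by rewrite subr_gt0.
  (* Odd, so that coordinate [n] takes the floor, and larger than [1/(u' - u)], so that the two
     products are at least 1 apart. *)
  pose n := (Num.truncn (u' - u)^-1).*2.+1.
  have : (Num.floor (u * n%:R) < Num.floor (u' * n%:R))%R.
    rewrite -lezD1 floor_ge_int intrD.
    apply: (@le_trans _ _ (u * n%:R + 1)%R); first by rewrite lerD2r floor_le.
    rewrite -lerBrDl -mulrBl -ler_pdivrMl// mulr1.
    by apply: le_trans (ltW (truncnS_gt _)) _; rewrite ler_nat /n ltnS -addnn leq_addr.
  by have := congr1 (fun f => f n) zz; rewrite /zeta /n /= odd_double /= => ->; rewrite ltxx.
have mz n v : measurable [set u | zeta u n = v].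
  rewrite /zeta; case: (odd n); last first.
    have [->|h] := eqVneq v 0%R; first by rewrite (_ : [set u | _] = setT)//; apply/seteqP.
    rewrite (_ : [set u | _] = set0)//; apply/seteqP; split=> // u /= h0.
    by rewrite -h0 eqxx in h.
  have mc : measurable_fun setT (fun u : R => u * n%:R)%R by exact: mulrr_measurable.
  have := mc measurableT _ (measurable_itv `[v%:~R, (v + 1)%:~R[%R); rewrite setTI.
  congr measurable; apply/seteqP; split=> u; rewrite /= in_itv /=.
    by move=> /floor_def.
  by move=> <-; exact: floor_itv.
have [mu muE] := pushforward_probability (unif R) mz.
exists mu => g h; rewrite muE.
have [[u [z Ez zu]]|hn] := pselect (exists u, translate g E h (zeta u)); last first.
  rewrite (_ : _ @^-1` _ = set0) ?measure0//; apply/seteqP; split=> // u hu.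
  by apply: hn; exists u.
(* [zeta] vanishes on even coordinates, so the points of [E] behind two hits of the translate have
   equal even coordinates, hence equal [rho]. *)
rewrite (_ : _ @^-1` _ = [set u]) ?unif1//; apply/seteqP; split=> [u' [z' Ez' zu']|_ ->].
  apply: zeta_inj; suff zz : z = z' by rewrite -zu' -zu zz.
  apply: inj => //; apply: funext => i; congr (Posz (decode _)).
  have := congr1 (fun f => f i.*2) zu; have := congr1 (fun f => f i.*2) zu'.
  rewrite /zeta /zadd odd_double => <- /addIr/addrI ->; reflexivity.
by exists z.
Qed.

End Phi.

(** * The quantile map of a law on Z^omega *)

Definition encode (v : int) : nat := pickle v.

Lemma encode_inj : injective encode.
Proof. exact: (pcan_inj pickleK). Qed.

(** Coding integers by naturals lists the one-step extensions of a cylinder as a sequence, in the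
    order in which the unit interval will be cut. *)
Fixpoint ncyl (s : seq nat) : set Zomega :=
  if s is j :: s' then ncyl s' `&` [set z | encode (z (size s')) = j] else setT.

Lemma open_ncyl s : open (ncyl s).
Proof.
elim: s => [|j s IH] /=; first exact: openT.
apply: openI => //; exact: (open_coordinate (size s) (fun v => encode v = j)).
Qed.

Lemma ncyl_drop k s : ncyl s `<=` ncyl (drop k s).
Proof. by elim: s k => [|j s IH] [|k] //= z [/IH]. Qed.

Lemma ncyl_uniq s s' z : size s = size s' -> ncyl s z -> ncyl s' z -> s = s'.
Proof.
elim: s s' => [|j s IH] [|j' s'] //= [ss] [hz hj] [hz' hj'].
by rewrite -hj -hj' ss (IH s').
Qed.

Definition nprefix (z : Zomega) n : seq nat := rev (mkseq (fun i => encode (z i)) n).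

Lemma size_nprefix z n : size (nprefix z n) = n.
Proof. by rewrite size_rev size_mkseq. Qed.

Lemma ncyl_nprefix z n : ncyl (nprefix z n) z.
Proof.
elim: n => // n IH; rewrite /nprefix /mkseq -addn1 iotaD map_cat rev_cat /=.
by split=> //; rewrite /= size_rev size_map size_iota add0n.
Qed.

Lemma ncyl_coordinates s z z' i : ncyl s z -> ncyl s z' -> (i < size s)%N -> z' i = z i.
Proof.
elim: s => //= j s IH [hz hj] [hz' hj']; rewrite ltnS leq_eqVlt => /orP[/eqP->|]; last exact: IH.
by apply: encode_inj; rewrite hj hj'.
Qed.

(** Two cylinders are nested or disjoint. Together with the empty set they form the generating
    system on which laws will be compared. *)
Lemma ncyl_setI_closed : setI_closed [set A | A = set0 \/ exists s, A = ncyl s].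
Proof.
move=> A B [->|[s ->]]; first by rewrite set0I; left.
move=> [->|[s' ->]]; first by rewrite setI0; left.
wlog ss : s s' / (size s <= size s')%N.
  move=> h; have [/h//|/ltnW/h] := leqP (size s) (size s'); by rewrite setIC.
have [e|ne] := eqVneq (drop (size s' - size s) s') s.
  by right; exists s'; rewrite setIidr// -e; exact: ncyl_drop.
left; apply/seteqP; split=> // z [hz hz'].
suff : drop (size s' - size s) s' = s by move/eqP: ne.
by apply: (ncyl_uniq _ (@ncyl_drop _ _ z hz') hz); rewrite size_drop subKn.
Qed.

Lemma Borel_ncyl A : Borel A -> <<s [set A | A = set0 \/ exists s, A = ncyl s] >> A.
Proof.
apply: smallest_sub; first exact: smallest_sigma_algebra.
move=> {}A oA; pose D (c : option (seq nat)) :=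
  if c is Some s then if `[< ncyl s `<=` A >] then ncyl s else set0 else set0.
rewrite (_ : A = \bigcup_k D (unpickle k)).
  have [h0 _ hU] := smallest_sigma_algebra setT [set A | A = set0 \/ exists s, A = ncyl s].
  apply: hU => k; rewrite /D; case: (unpickle k) => [s|]; last exact: h0.
  case: ifP => _; last exact: h0.
  by apply: sub_gen_smallest; right; exists s.
apply/seteqP; split=> z.
  move=> Az; have /open_prefixP/(_ z Az)[n hn] := oA.
  exists (pickle (nprefix z n)) => //; rewrite pickleK /D asboolT; first exact: ncyl_nprefix.
  move=> z' hz'; apply: hn => i ni.
  by apply: ncyl_coordinates (ncyl_nprefix z n) hz' _; rewrite size_nprefix.
move=> [k _]; rewrite /D; case: (unpickle k) => // s.
by case: asboolP => // sA /sA.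
Qed.

Section Quantile.
Variables (R : realType) (mu : probability borelZ R).

Let m s : R := pr mu (ncyl s).
Let G s k : R := pr mu (ncyl s `&` [set z | encode (z (size s)) < k]%N).

Let meas_open (A : set Zomega) : open A -> measurable (A : set borelZ).
Proof. by move=> oA; have : Borel A by exact: sub_gen_smallest. Qed.

Let meas_ncyl s : measurable (ncyl s : set borelZ).
Proof. by apply: meas_open; exact: open_ncyl. Qed.

Let meas_G s k : measurable (ncyl s `&` [set z | encode (z (size s)) < k]%N : set borelZ).
Proof.
apply: meas_open; apply: openI; first exact: open_ncyl.
exact: (open_coordinate (size s) (fun v => encode v < k)%N).
Qed.

Let G0 s : G s 0 = 0%R.
Proof. by rewrite /G (_ : _ `&` _ = set0) ?/pr ?measure0//; apply/seteqP; split=> // z []. Qed.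

Let GS s k : G s k.+1 = (G s k + m (k :: s))%R.
Proof.
rewrite /G /m /=; have mA := meas_G s k; have mB := meas_ncyl (k :: s).
apply: EFin_inj; rewrite EFinD -(prE mu (meas_G s k.+1)) -(prE mu mA) -(prE mu mB).
rewrite -measureU//; last first.
  by apply/seteqP; split=> // z [[_ /= h] [_ /= e]]; rewrite e ltnn in h.
congr (mu _); apply/seteqP; split=> z.
  by move=> [hz /=]; rewrite ltnS leq_eqVlt => /orP[/eqP|]; [right|left].
by move=> [|] [hz /= h]; split=> //=; [exact: ltnW|rewrite h].
Qed.

Let G_le s k : (G s k <= m s)%R.
Proof. by apply: pr_le; [exact: meas_G|exact: meas_ncyl|move=> z []]. Qed.

Let G_mono s k k' : (k <= k')%N -> (G s k <= G s k')%R.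
Proof.
move=> kk; apply: pr_le; [exact: meas_G|exact: meas_G|].
by move=> z [? h]; split=> //=; exact: leq_trans kk.
Qed.

(* The unit interval is cut lexicographically into intervals of lengths [m s], one
   for each initial segment [s]; as for histories, [s] lists the latest entry first. *)
Fixpoint left_end s : R := if s is j :: s' then (left_end s' + G s' j)%R else 0%R.

Definition itv_of s : set R := `[left_end s, (left_end s + m s)%R[.

Lemma itv_ofP s u : itv_of s u <-> (left_end s <= u < left_end s + m s)%R.
Proof. by rewrite /itv_of /= in_itv. Qed.

Lemma itv_of_cons j s : itv_of (j :: s) `<=` itv_of s.
Proof.
move=> u /itv_ofP /= /andP[h1 h2]; apply/itv_ofP; apply/andP; split.
  by apply: le_trans h1; rewrite lerDl; exact: pr_ge0.
by apply: lt_le_trans h2 _; rewrite -addrA -GS lerD2l.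
Qed.

Lemma itv_of_nil : itv_of [::] = `[0%R, 1%R[.
Proof. by rewrite /itv_of /= add0r /m /= /pr probability_setT. Qed.

Lemma itv_of_sub s : itv_of s `<=` `[0%R, 1%R[.
Proof. by rewrite -itv_of_nil; elim: s => // j s IH u /itv_of_cons/IH. Qed.

Lemma left_end_ge0 s : (0 <= left_end s)%R.
Proof. by elim: s => //= j s h; apply: addr_ge0 => //; exact: pr_ge0. Qed.

Lemma left_end_le1 s : (left_end s + m s <= 1)%R.
Proof.
elim: s => [|j s]; first by rewrite add0r /m /= /pr probability_setT.
by apply: le_trans; rewrite /= -addrA -GS lerD2l.
Qed.

(** If [j < j'], the interval of [j :: s] ends at offset [G s j.+1], which is at most the offset
    [G s j'] where that of [j' :: s] begins. *)
Lemma itv_of_uniq s s' u : size s = size s' -> itv_of s u -> itv_of s' u -> s = s'.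
Proof.
elim: s s' => [|j s IH] [|j' s'] //= [ss] hu hu'.
have e := IH _ ss (itv_of_cons hu) (itv_of_cons hu'); subst s'; congr cons.
move: hu hu' => /itv_ofP/andP[/= h1 h2] /itv_ofP/andP[/= h1' h2'].
rewrite -addrA -GS in h2; rewrite -addrA -GS in h2'.
by have [/(G_mono s)|/(G_mono s)|//] := ltngtP j j' => h; exfalso; clear IH ss; lra.
Qed.

(** The cumulative masses [G s k] increase to [m s]. The least [k] whose mass passes
    [u - left_end s] is positive because [G s 0] is zero, and its predecessor is the entry
    sought. *)
Lemma itv_of_split s u : itv_of s u -> exists j, itv_of (j :: s) u.
Proof.
move=> /itv_ofP/andP[h1 h2].
have [|||k hk] := @pr_bigcup_gt _ _ _ mu (fun k => ncyl s `&` [set z | encode (z (size s)) < k]%N)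
    (u - left_end s)%R.
- by move=> n; exact: (meas_G s n).
- by move=> a b ab z [? h]; split=> //=; exact: (leq_trans h ab).
- rewrite ltrBlDl (_ : \bigcup_n _ = ncyl s)//; apply/seteqP; split=> [z [? _ []]//|z hz].
  by exists (encode (z (size s))).+1 => //; split=> //=.
have ex1 : exists k, (u - left_end s < G s k)%R by exists k.
case: (ex_minnP ex1) => -[|j] hj hmin; first by move: hj; rewrite G0; lra.
exists j; apply/itv_ofP => /=; rewrite -addrA -GS; apply/andP; split; last by lra.
have : ~~ (u - left_end s < G s j)%R by apply/negP => /hmin; rewrite ltnn.
by rewrite -leNgt; lra.
Qed.

Lemma itv_of_total u n : `[0%R, 1%R[%classic u -> exists2 s, size s = n & itv_of s u.
Proof.
move=> u01; elim: n => [|n [s <- /itv_of_split[j hj]]]; last by exists (j :: s).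
by exists [::] => //; rewrite itv_of_nil.
Qed.

Lemma ncyl_nonempty s u : itv_of s u -> exists z, ncyl s z.
Proof.
move=> /itv_ofP/andP[h1 h2]; apply: contrapT => /forallNP h.
have m0 : m s = 0%R.
  by rewrite /m (_ : ncyl s = set0) ?/pr ?measure0//; apply/seteqP; split=> // z /h.
by move: h2; rewrite m0; lra.
Qed.

(** The intervals containing [u] form a coherent branch, whose entries code the coordinates of
    [q u]. Such an interval has positive length, so its cylinder is nonempty and its entries do code
    integers. *)
Lemma quantile_exists : exists q : R -> Zomega,
  (forall u s, `[0%R, 1%R[%classic u -> ncyl s (q u) <-> itv_of s u) /\
  (forall u, ~ `[0%R, 1%R[%classic u -> q u = fun=> 0%R).
Proof.
have /choice[q hq] : forall u, exists z : Zomega,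
    (`[0%R, 1%R[%classic u -> forall s, ncyl s z <-> itv_of s u) /\
    (~ `[0%R, 1%R[%classic u -> z = fun=> 0%R).
  move=> u; have [u01|u01] := pselect (`[0%R, 1%R[%classic u); last by exists (fun=> 0%R).
  have /choice[b hb] : forall n, exists s, size s = n /\ itv_of s u.
    by move=> n; have [s ? ?] := itv_of_total n u01; exists s.
  have bE s : itv_of s u -> b (size s) = s.
    by have [sb hb'] := hb (size s); exact: itv_of_uniq sb hb'.
  have /choice[z hz] : forall i, exists v : int, encode v = head 0 (b i.+1).
    move=> i; have [+ hb'] := hb i.+1; have [z] := ncyl_nonempty hb'.
    by case: (b i.+1) => //= j s [_ hj] _; exists (z (size s)).
  have zs s : itv_of s u -> ncyl s z.
    elim: s => // j s IH hs; split; first exact/IH/itv_of_cons/hs.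
    by rewrite /= hz; have := bE _ hs; rewrite /= => ->.
  exists z; split=> // _ s; split=> [sz|]; last exact: zs.
  have [sb hb'] := hb (size s).
  by rewrite -(ncyl_uniq sb (zs _ hb') sz).
by exists q; split=> u; have [] := hq u => h1 h2; [move=> s u01; exact: h1|exact: h2].
Qed.

End Quantile.

(** * Law of the quantile map and its approximation by step functions *)

Section Coupling.
Variables (R : realType) (mu : probability borelZ R) (q : R -> Zomega).
Hypothesis q_ncyl : forall u s, `[0%R, 1%R[%classic u -> ncyl s (q u) <-> itv_of mu s u.
Hypothesis q_out : forall u, ~ `[0%R, 1%R[%classic u -> q u = fun=> 0%R.

Lemma measurable_quantile n (v : int) : measurable [set u | q u n = v].
Proof.
pose D (c : option (seq nat)) : set R := if c is Some s then
  if (head 0 s == encode v) && (size s == n.+1) then itv_of mu s else set0 else set0.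
have mD c : measurable (D c).
  rewrite /D; case: c => [s|]; last exact: measurable0.
  by case: ifP => _; [exact: measurable_itv|exact: measurable0].
rewrite (_ : [set u | _] = \bigcup_k D (unpickle k) `|`
    (~` `[0%R, 1%R[ `&` [set u | 0%R = v])).
  apply: measurableU; first by apply: bigcup_measurable => k _; exact: mD.
  apply: measurableI; first by apply: measurableC; exact: measurable_itv.
  have [v0|v0] := pselect (0%R = v).
    by rewrite (_ : [set _ | _] = setT)//; apply/seteqP; split.
  by rewrite (_ : [set _ | _] = set0)//; apply/seteqP; split=> // ? /v0.
apply/seteqP; split=> u.
  rewrite [X in X -> _]/= => quv; have [u01|u01] := pselect (`[0%R, 1%R[%classic u); last first.
    by right; split=> //; rewrite -quv q_out.
  left; have [s sn hs] := itv_of_total mu n.+1 u01.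
  exists (pickle s) => //; rewrite pickleK /D sn eqxx andbT.
  have /(q_ncyl s u01) := hs; case: s sn {hs} (hs) => //= j s [sn] hs [_].
  by rewrite sn quv => ->; rewrite eqxx.
move=> [[k _]|[u01]]; last by rewrite /= q_out.
rewrite /D; case: (unpickle k) => // s; case: ifP => // /andP[/eqP hs /eqP sn] su.
have u01 := itv_of_sub su; have /(q_ncyl s u01) := su.
case: s hs sn {su} => //= j s -> [<-] [_]; exact: encode_inj.
Qed.

Lemma measurable_quantile_preimage A : Borel A -> measurable (q @^-1` A).
Proof. exact: measurable_preimage_Borel measurable_quantile A. Qed.

Lemma unif_co (A : set R) : measurable A -> unif R A = unif R (A `&` `[0%R, 1%R[).
Proof.
move=> mA; have mI : measurable (`[0%R, 1%R[ : set R) by exact: measurable_itv.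
have nI : unif R (~` `[0%R, 1%R[) = 0%E.
  by rewrite probability_setC// unif_itv// subr0 subee.
apply/eqP; rewrite eq_le; apply/andP; split; last first.
  by apply: le_measure; rewrite ?inE//; try exact: measurableI; exact: subIsetl.
rewrite -[leRHS]adde0 -[in leRHS]nI.
apply: le_trans (measureU2 _ _ _); rewrite ?inE//; try exact: measurableI; try exact: measurableC.
apply: le_measure; rewrite ?inE//.
  by apply: measurableU; [exact: measurableI|exact: measurableC].
by move=> u Au; have [uI|uI] := pselect (`[0%R, 1%R[%classic u); [left|right].
Qed.

(** Both laws give a cylinder the length of its interval, and cylinders determine a law. *)
Lemma quantile_law A : Borel A -> unif R (q @^-1` A) = mu A.
Proof.
move=> /Borel_ncyl gA.
have [nu nuE] := pushforward_probability (unif R) measurable_quantile.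
rewrite -nuE; pose G : set (set borelZ) := [set A | A = set0 \/ exists s, A = ncyl s].
apply: (@g_sigma_algebra_measure_unique _ R borelZ G _ (fun=> setT) _ _ nu mu
  ncyl_setI_closed _ _ A gA).
- move=> B [->|[s ->]]; first exact: measurable0.
  have : Borel (ncyl s) by apply: sub_gen_smallest; exact: open_ncyl.
  exact.
- by move=> _; right; exists [::].
- by rewrite bigcup_const//; exists 0.
- move=> B [->|[s ->]]; first by rewrite !measure0.
  have bs : Borel (ncyl s) by apply: sub_gen_smallest; exact: open_ncyl.
  apply: etrans (nuE _) _; rewrite unif_co; last exact: measurable_quantile_preimage.
  rewrite (_ : _ `&` _ = itv_of mu s); last first.
    apply/seteqP; split=> u; first by move=> [/= h u01]; apply/q_ncyl.
    by move=> su; have u01 := itv_of_sub su; split=> //; apply/q_ncyl.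
  rewrite /itv_of unif_itv.
  + by rewrite addrAC subrr add0r -prE.
  + exact: left_end_ge0.
  + by rewrite lerDl pr_ge0.
  + exact: left_end_le1.
- by move=> _; have : (nu setT < +oo)%E by rewrite probability_setT ltry.
Qed.

Lemma measurable_step_quantile l n : measurable [set u | step l u = q u n].
Proof.
pose D (c : option int) : set R :=
  if c is Some v then [set u | step l u = v] `&` [set u | q u n = v] else set0.
rewrite (_ : [set u | _] = \bigcup_k D (unpickle k)).
  apply: bigcup_measurable => k _; rewrite /D; case: (unpickle k) => [v|]; last exact: measurable0.
  by apply: measurableI; [exact: measurable_step|exact: measurable_quantile].
apply/seteqP; split=> u.
  by move=> h; exists (encode (step l u)); [|rewrite /encode pickleK].
by move=> [k _]; rewrite /D; case: (unpickle k) => // v [/= sv qv]; rewrite sv.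
Qed.

(* Sampling at the right end points [(k+1)/N] makes the approximations converge
   pointwise everywhere, because [q u n] is right-continuous in [u]. *)
Lemma quantile_step n (e : R) : (0 < e)%R ->
  exists l, (pr (unif R) (~` [set u | step l u = q u n]) < e)%R.
Proof.
move=> e0; pose l N := mkseq (fun k => q (k.+1%:R / N%:R)%R n) N.
pose good K := `[0%R, 1%R[ `&`
  \bigcap_(N in [set N | K <= N]%N) [set u | step (l N) u = q u n].
have m01 : measurable (`[0%R, 1%R[ : set R) by exact: measurable_itv.
have mgood K : measurable (good K).
  apply: measurableI => //; apply: bigcap_measurable; first by exists K => /=.
  by move=> N _; exact: measurable_step_quantile.
have good_cover : \bigcup_K good K = `[0%R, 1%R[.
  apply/seteqP; split=> [u [K _ []]//|u u01].
  have [s sn su] := itv_of_total mu n.+1 u01.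
  have /andP[u0 u1] : (0 <= u < 1)%R by move: u01; rewrite /= in_itv.
  have /itv_ofP/andP[h1 h2] := su.
  have d0 : (0 < left_end mu s + pr mu (ncyl s) - u)%R by rewrite subr_gt0.
  (* For [N >= K] the mesh [1/N] is below the distance from [u] to the right end of its interval, so
     the sample point stays in that interval and shares coordinate [n] with [u]. *)
  pose K := (Num.truncn (left_end mu s + pr mu (ncyl s) - u)^-1).+1.
  exists K => //; split=> // N /= KN.
  have N0 : (0 < N%:R :> R)%R by rewrite ltr0n (leq_trans _ KN).
  have uN : (u * N%:R < N%:R)%R by rewrite -[ltRHS]mul1r ltr_pM2r.
  have tN : (Num.truncn (u * N%:R)%R < N)%N.
    by rewrite truncn_lt_nat// mulr_ge0// ltW.
  rewrite /step size_mkseq nth_mkseq//; set k := Num.truncn _.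
  have k1 : (u < k.+1%:R / N%:R)%R by rewrite ltr_pdivlMr// truncnS_gt.
  have k2 : (k.+1%:R / N%:R <= u + N%:R^-1)%R.
    rewrite -natr1 mulrDl mul1r lerD2r ler_pdivrMr//.
    by rewrite truncn_le mulr_ge0// ltW.
  have k3 : (N%:R^-1 < left_end mu s + pr mu (ncyl s) - u)%R.
    rewrite invf_plt ?posrE//; apply: lt_le_trans (truncnS_gt _) _.
    by rewrite ler_nat.
  have sk : itv_of mu s (k.+1%:R / N%:R)%R by apply/itv_ofP/andP; split; lra.
  have k01 := itv_of_sub sk; have /(q_ncyl _ k01) hk := sk.
  have /(q_ncyl _ u01) hu := su.
  by apply: ncyl_coordinates hu hk _; rewrite sn.
have pr01 : pr (unif R) (`[0%R, 1%R[) = 1%R by rewrite /pr unif_itv//= subr0.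
have [|||K hK] := @pr_bigcup_gt _ _ _ (unif R) good (1 - e)%R.
- exact: mgood.
- by move=> a b ab u [u01 hu]; split=> // N /= bN; apply: hu => /=; exact: leq_trans bN.
- by rewrite good_cover pr01 ltrBlDr ltrDl.
exists (l K); rewrite pr_setC; last exact: measurable_step_quantile.
rewrite ltrBlDr -ltrBlDl; apply: lt_le_trans hK _.
apply: pr_le; [exact (mgood K)|exact (measurable_step_quantile (l K) n)|].
by move=> u [_ /(_ K (leqnn K))].
Qed.

End Coupling.

(** * The theorem *)

(** Off an event of probability at most 1/2, [phi x u] is a fixed translate of the quantile map, and
    that translate almost surely avoids [B]. *)
Lemma coupling (R : realType) (mu : probability borelZ R) (d : nat -> nat) (B : set Zomega) :
  Borel B -> (forall g h, mu (translate g B h : set borelZ) = 0%E) ->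
  exists x, [/\ exists z, x = rho z, forall i, (param (absz (x i))).2 = d i &
    (kappa (unif R) (@phi R) x B < 1)%R].
Proof.
move=> bB mB; have [q [q_ncyl q_out]] := quantile_exists mu.
have mq := measurable_quantile q_ncyl q_out.
(* The error bounds 1/4, 1/8 and so on add up to 1/2, which stays below one. *)
have /choice[l hl] : forall n, exists l,
    (pr (unif R) (~` [set u | step l u = q u n]) < 2^-1 ^+ n.+2)%R.
  by move=> n; apply: (quantile_step q_ncyl q_out); rewrite exprn_gt0// invr_gt0.
pose m i := pickle (l i.*2, l i.*2.+1, d i).
pose x : Zomega := fun i => Posz (m i).
exists x; split; last 1 first.
(* The shift by the block centres does not depend on [u]; it is harmless because every translate of
   [B] is null. *)
- pose c : Zomega := fun i => if odd i then 0%R else center (m i./2).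
  pose N n := ~` [set u | step (l n) u = q u n].
  have mN n : measurable (N n).
    by apply: measurableC; exact: (measurable_step_quantile q_ncyl q_out).
  pose U n := \bigcup_(i in `I_n) N i.
  have mU n : measurable (U n) by apply: bigcup_measurable.
  have prU n : (pr (unif R) (U n) <= 2^-1 - 2^-1 ^+ n.+1)%R.
    elim: n => [|n IH]; first by rewrite /U II0 bigcup_set0 /pr measure0 expr1 subrr.
    rewrite {1}/U IIS bigcup_setU bigcup_set1 -/(U n).
    have : (pr (unif R) (U n `|` N n) <= pr (unif R) (U n) + pr (unif R) (N n))%R.
      by apply: pr_setU; [exact: mU|exact: mN].
    by have := hl n; rewrite -/(N n) exprS; rewrite exprS in IH *; lra.
  have prN : (pr (unif R) (\bigcup_n U n) <= 2^-1)%R.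
    rewrite leNgt; apply/negP => /pr_bigcup_gt[|a b ab u [i /= ia Ni]|n] //.
      by exists i => //=; exact: (leq_trans ia ab).
    by have := prU n; have : (0 < 2^-1 ^+ n.+1 :> R)%R; [by rewrite exprn_gt0// invr_gt0|lra].
  have bC : Borel [set y | B (zadd c y)].
    apply: (@measurable_preimage_Borel _ borelZ (zadd c)) bB => n v.
    have : Borel [set y : Zomega | (c n + y n)%R = v].
      apply: sub_gen_smallest.
      exact: (open_coordinate n (fun w => (c n + w)%R = v)).
    exact.
  have null : unif R (q @^-1` [set y | B (zadd c y)]) = 0%E.
    rewrite (quantile_law q_ncyl q_out bC) -(mB (fun i => - c i)%R (fun=> 0%R)).
    congr (mu _); apply/seteqP; split=> y.
      move=> By; exists (zadd c y) => //; apply: funext => i.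
      by rewrite /zadd addr0 addrA addNr add0r.
    move=> [b Bb <-] /=; rewrite (_ : zadd _ _ = b)//; apply: funext => i.
    by rewrite /zadd addr0 addrA subrr add0r.
  have mqB : measurable (q @^-1` [set y | B (zadd c y)]).
    exact: (measurable_preimage_Borel mq bC).
  have mUU : measurable (\bigcup_n U n) by exact: bigcup_measurable.
  have mphiB : measurable (phi x @^-1` B : set R).
    exact: (measurable_preimage_Borel (@phi_meas R x) bB).
  have : (kappa (unif R) (@phi R) x B <= pr (unif R) (\bigcup_n U n) +
      pr (unif R) (q @^-1` [set y | B (zadd c y)]))%R.
    apply: (@le_trans _ _ (pr (unif R) (\bigcup_n U n `|` q @^-1` [set y | B (zadd c y)]))).
      2: by apply: pr_setU.
    apply: pr_le => //; first exact: measurableU.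
    move=> u Bu; have [h|h] := pselect (forall n, step (l n) u = q u n); last first.
      left; move: h => /existsNP[n hn]; exists n.+1 => //.
      by exists n => //=.
    right; rewrite /=; suff <- : phi x u = zadd c (q u) by [].
    apply: funext => i; rewrite /phi /zadd /c -h /x /= /m paramK /=.
    have := odd_double_half i; case: (odd i) => /= e; first by rewrite add0r -[in RHS]e.
    by congr (_ + step (l _) u)%R.
  have -> : pr (unif R) (q @^-1` [set y | B (zadd c y)]) = 0%R by rewrite /pr null.
  by rewrite addr0 => /le_trans/(_ prN); lra.
- exists (fun i => center (m i./2)); apply: funext => i; rewrite /rho /x doubleK.
  by rewrite -[center _]addr0 decode_center// normr0.
- by move=> i; rewrite /x /= /m paramK.
Qed.

Theorem theorem5p1 (R : realType) (xi : cord) :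
  ole otwo xi ->
  exists E : set Zomega,
    [/\ HaarNull R E,
        (exists A B : set Zomega, [/\ Pi0 xi A, Pi0 xi B & E = A `\` B]) &
        ~ (exists F : set Zomega, [/\ Pi0 xi F, HaarNull R F & E `<=` F])].
Proof.
move=> xi2; have xi1 : olt oone xi by inversion xi2.
pose delta (z : Zomega) n := (param (decode (z n.*2))).2.
have [|W sW hW] := @Sigma0_universal xi delta (oltW xi1).
  by move=> n Q; exact: (open_coordinate n.*2 (fun v => Q (param (decode v)).2)).
have [A [B [pA pB inj sel]]] :=
  selection (unif R) (@phi_local R) (@phi_meas R) rho_local (@rho_phi R) xi1 sW.
exists (A `\` B); split; last 2 first.
- by exists A, B.
- move=> [F [pF [C [bC FC [mu muC]]] EF]].
  (* [Pi0 xi F] unfolds to a statement on the complement of [F], so [d] codes that complement. *)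
  have [d hd] := hW _ pF.
  have [x [[z0 xz0] xd kC]] := coupling d bC muC.
  (* [delta] factors through [rho], which is constant along [phi x]; hence [W] and the complement of
     [F] agree at every [phi x u]. *)
  have dx (u : R) n : delta (phi x u) n = d n.
    have := congr1 (fun f => f n) (rho_phi z0 u); rewrite -xz0 /rho /delta => e.
    by rewrite -xd -e.
  have kW : (0 < kappa (unif R) (@phi R) x W)%R.
    have -> : kappa (unif R) (@phi R) x W = kappa (unif R) (@phi R) x (~` F).
      rewrite /kappa; congr (pr _ _); apply/seteqP; split=> u /=.
        by move=> /(hd _ (dx u)).
      by move=> h; apply/(hd _ (dx u)).
    have bF : Borel F by rewrite -(setCK F); apply: Borel_setC; exact: Sigma0_Borel pF.
    have -> : kappa (unif R) (@phi R) x (~` F) = (1 - kappa (unif R) (@phi R) x F)%R.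
      by apply: kappa_setC bF => ? ? ?; exact: phi_meas.
    rewrite subr_gt0; apply: le_lt_trans kC.
    apply: pr_le; [| |by move=> u /FC].
    + exact: (measurable_preimage_Borel (@phi_meas R x) bF).
    + exact: (measurable_preimage_Borel (@phi_meas R x) bC).
  have [z [Ez zx Wz]] := sel x (ex_intro _ z0 xz0) kW.
  suff /(_ (EF _ Ez)) : ~ F z by [].
  apply/(hd z) => // n; rewrite /delta -xd -zx /rho.
  by [].
- apply: rho_HaarNull => //.
  (* The difference is Borel because it lies in the additive class one level up. *)
  have lt : olt xi (OS xi) by exact/olt_S/ole_refl.
  apply: (@Sigma0_Borel (OS xi)); rewrite setDE; apply: Sigma0I.
    by rewrite -(setCK A); exact: Sigma0_setC_lt pA.
  exact: Sigma0_lt pB.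
Qed.
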